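(* Let $E\to M$ be a Courant algebroid that is reducible with respect to geometric coisotropic data $(N,K,F,\nabla)$, and assume that $F$ is simple and $\nabla$ has trivial holonomy, with reduced Courant algebroid $E_{red}\to\underline N$. Let $L$ be a Dirac structure in $E$ with support on a submanifold $S\subseteq M$ containing $N$. Suppose that (a) $L|_N\cap K$ has constant rank, and (b) the lagrangian subbundle $L_{quot}=\dfrac{(K^\perp\cap L|_N)+K}{K}$ in $E_{quot}=K^\perp/K$ is $\nabla$-invariant, i.e., $\nabla_Y(\Gamma_{L_{quot}})\subseteq\Gamma_{L_{quot}}$ for any section $Y$ of $F$. Then the quotient of $L_{quot}$ with respect to $F$ and $\nabla$ is a Dirac structure $L_{red}\subset E_{red}$.
   Context: Manifolds and vector bundles are smooth and real; $\Gamma_A$ is the sheaf of sections of $A$. **Courant algebroid.** A vector bundle $E\to M$ with a fiberwise symmetric non-degenerate form $\langle\cdot,\cdot\rangle$, a bundle map $\rho\colon E\to TM$ (anchor) and a bilinear bracket on $\Gamma(E)$ with: $[\![e_1,[\![e_2,e_3]\!]]\!]=[\![[\![e_1,e_2]\!],e_3]\!]+[\![e_2,[\![e_1,e_3]\!]]\!]$; $[\![e_1,fe_2]\!]=f[\![e_1,e_2]\!]+(\mathcal L_{\rho(e_1)}f)e_2$; $\mathcal L_{\rho(e_1)}\langle e_2,e_3\rangle=\langle[\![e_1,e_2]\!],e_3\rangle+\langle e_2,[\![e_1,e_3]\!]\rangle$; $\rho([\![e_1,e_2]\!])=[\rho(e_1),\rho(e_2)]$; $\langle e_1,[\![e_2,e_2]\!]\rangle=\frac12\mathcal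 L_{\rho(e_1)}\langle e_2,e_2\rangle$. **Dirac structures with support.** A Dirac structure in $E$ supported on a submanifold $S\subseteq M$ is a lagrangian subbundle $L\to S$ of $E|_S$ ($L=L^\perp$) with $\rho(L)\subseteq TS$ and such that $[\![e_1,e_2]\!]|_S\in\Gamma(L)$ for all $e_1,e_2\in\Gamma(E)$ with $e_1|_S,e_2|_S\in\Gamma(L)$. A Dirac structure is one with $S=M$ (for $E_{red}$: support all of $\underline N$). **Geometric coisotropic data** $(N,K,F,\nabla)$: $N\subseteq M$ a submanifold; $K\subseteq E|_N$ an isotropic subbundle; $F\subseteq TN$ an integrable subbundle; $\nabla$ a flat $F$-connection on $E_{quot}=K^\perp/K\to N$ preserving the induced metric. $[\cdot]\colon K^\perp\to E_{quot}$ is the projection. $\Gamma_{A,B}$ denotes the sheaf of sections of $A\to M$ whose restriction to $N$ lies in $B\to N$; $\Gamma^{flat}_{E,K^\perp}$ is the sheaf of $e\in\Gamma_{E,K^\perp}$ with $[e|_N]$ $\nabla$-flat. **Simple, trivial holonomy, quotient.** $F$ is simple if there is a surjective submersion $p\colon N\to\underline N$ with connected fibres and $\ker dp=F$. With $\mathcal R_p=N\times_{\underline N}N$, a flat $F$-connection on $A\to N$ has trivial holonomy if it arises by differentiation from a representation of the groupoid $\mathcal R_p$ on $A$; equivalently there is a vector bundle $\underline A\to\underline N$ (unique up to isomorphism; the quotient of $A$ with respect to $F$ and $\nabla$) with $A\cong p^*\underline A$ and pullback of sections $p^\sharp$ an isomorphism from $\Gamma_{\underline A}$ onto $p_*$ of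 the sheaf of flat sections of $A$. $E_{red}$ denotes the quotient of $E_{quot}$; it inherits a pseudo-euclidean structure. **Reducibility.** $E$ is reducible with respect to $(N,K,F,\nabla)$ if $\rho(K^\perp)\subseteq TN$, $\rho(K)\subseteq F$, $[\rho(\Gamma^{flat}_{E,K^\perp}),\Gamma_{TM,F}]\subseteq\Gamma_{TM,F}$, and $[\![\Gamma^{flat}_{E,K^\perp},\Gamma^{flat}_{E,K^\perp}]\!]\subseteq\Gamma^{flat}_{E,K^\perp}$. Then $E_{red}$ is a Courant algebroid with $\rho_{red}(\underline e)=p_*(\rho(e))$ and $p^\sharp[\![\underline e_1,\underline e_2]\!]_{red}=\big[[\![e_1,e_2]\!]|_N\big]$, where $e$ is a section of $K^\perp$ with $[e]=p^\sharp\underline e$ and $e_i\in\Gamma^{flat}_{E,K^\perp}$ with $[e_i|_N]=p^\sharp\underline e_i$. *)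

(* Defs.v *)
(* Conventions.
   - Manifolds are pure-dimensional, Hausdorff and second countable, given by
     charts; submanifolds are embedded, given by their inclusion map.
   - A (local) section is a function on the whole base; only its values on the
     open set under consideration matter.  A bundle carries the germwise
     predicate "s is smooth on a neighbourhood of x", so that the sections over
     an open set form a sheaf by construction. *)
From HB Require Import structures.
From mathcomp Require Import all_boot all_order all_algebra.
From mathcomp Require Import sesquilinear.
From mathcomp Require Import all_classical all_reals all_analysis.

Set Implicit Arguments.
Unset Strict Implicit.
Unset Printing Implicit Defensive.

Import Order.TTheory GRing.Theory Num.Theory.
Import numFieldNormedType.Exports.

Local Open Scope classical_set_scope.
Local Open Scope ring_scope.

Section SmoothMaps.
Context {R : realType} {n : nat} {W : normedModType R}.

Fixpoint Ck (k : nat) (U : set 'rV[R]_n) (f : 'rV[R]_n -> W) : Prop :=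
  if k is k'.+1 then
    (forall x, U x -> differentiable f x) /\
    (forall v, Ck k' U (fun x => 'd f x v))
  else forall x, U x -> {for x, continuous f}.

Definition smooth_near (a : 'rV[R]_n) (f : 'rV[R]_n -> W) : Prop :=
  exists U : set 'rV[R]_n, [/\ open U, U a & forall k, Ck k U f].

End SmoothMaps.

Record chart (R : realType) (T : topologicalType) (n : nat) := Chart {
  cdom : set T;
  cto :> T -> 'rV[R]_n;
  cinv : 'rV[R]_n -> T;
  cdom_open : open cdom;
  cimg_open : open (cto @` cdom);
  ctoK : forall x, cdom x -> cinv (cto x) = x;
  cto_continuous : forall x, cdom x -> {for x, continuous cto};
  cinv_continuous : forall z, (cto @` cdom) z -> {for z, continuous cinv} }.

(* The atlas is the family [chart_at x], [x] ranging over the points. *)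
Record manifold (R : realType) := Manifold {
  mtop :> topologicalType;
  mdim : nat;
  chart_at : mtop -> chart R mtop mdim;
  chart_at_dom : forall x, cdom (chart_at x) x;
  chart_compat : forall x y z,
    cdom (chart_at x) z -> cdom (chart_at y) z ->
    smooth_near (chart_at x z) (chart_at y \o cinv (chart_at x));
  m_hausdorff : hausdorff_space mtop;
  m_second_countable : @second_countable mtop }.

Arguments chart_at {R m} x.

Section Manifolds.
Context {R : realType}.
Implicit Types M N : manifold R.

(* T_x M is identified with R^n by means of the preferred chart at x. *)
Definition tangent M (x : M) : vectType R := 'rV[R]_(mdim M).

Definition smooth_fun_at M (x : M) (f : M -> R) : Prop :=
  smooth_near (chart_at x x) (f \o cinv (chart_at x)).

Definition smooth_fun_on M (U : set M) (f : M -> R) : Prop :=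
  forall x, U x -> smooth_fun_at x f.

Definition smooth_map M N (f : M -> N) : Prop :=
  continuous f /\
  forall x, smooth_near (chart_at x x) (chart_at (f x) \o f \o cinv (chart_at x)).

Definition tmap M N (f : M -> N) (x : M) (v : tangent x) : tangent (f x) :=
  'd (chart_at (f x) \o f \o cinv (chart_at x) : 'rV[R]_(mdim M) -> 'rV[R]_(mdim N))
     (chart_at x x) v.

Definition dirder M (x : M) (v : tangent x) (f : M -> R) : R :=
  'd (f \o cinv (chart_at x) : 'rV[R]_(mdim M) -> R) (chart_at x x) v.

Definition embedding M N (f : M -> N) : Prop :=
  [/\ smooth_map f, injective f, (forall x, injective (@tmap M N f x)) &
      forall U : set M, open U -> exists2 V : set N, open V & U = f @^-1` V].

Definition vfield M := forall x : M, tangent x.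

Definition vf_coord M (X : vfield M) (x : M) : 'rV[R]_(mdim M) -> 'rV[R]_(mdim M) :=
  fun z => let y := cinv (chart_at x) z in
  'd (chart_at x \o cinv (chart_at y) : 'rV[R]_(mdim M) -> 'rV[R]_(mdim M))
     (chart_at y y) (X y).

Definition lie M (X Y : vfield M) : vfield M := fun x =>
  'd (vf_coord Y x) (chart_at x x) (X x) - 'd (vf_coord X x) (chart_at x x) (Y x).

End Manifolds.

Arguments tmap {R M N} f x v.
Arguments dirder {R M} x v f.

Record bundle (R : realType) (M : manifold R) := Bundle {
  fib :> M -> vectType R;
  smooth_at : M -> (forall x, fib x) -> Prop }.

Section Bundles.
Context {R : realType}.
Implicit Types M N : manifold R.

Definition section M (B : bundle M) := forall x : M, B x.

Definition secs M (B : bundle M) (U : set M) (s : section B) : Prop :=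
  forall x, U x -> smooth_at x s.

Definition subsecs M (B : bundle M) (L : forall x, {vspace B x})
    (U : set M) (s : section B) : Prop :=
  secs U s /\ forall x, U x -> s x \in L x.

Definition frame M (B : bundle M) r (e : 'I_r -> section B) (x : M) : r.-tuple (B x) :=
  [tuple e j x | j < r].

(* Near every point there is a frame, and a section is smooth iff its
   coefficients in the frame are. *)
Definition is_vbundle M (B : bundle M) : Prop :=
  forall x, exists (U : set M) (r : nat) (e : 'I_r -> section B),
    [/\ open U, U x,
        (forall y, U y -> basis_of fullv (frame e y)) &
        forall y (s : section B), U y ->
          (smooth_at y s <->
           forall j, smooth_fun_at y (fun z => coord (frame e z) j (s z)))].

Definition is_subbundle M (B : bundle M) (L : forall x, {vspace B x}) : Prop :=
  forall x, exists (U : set M) (r : nat) (e : 'I_r -> section B),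
    [/\ open U, U x, (forall j, secs U (e j)) &
        forall y, U y -> basis_of (L y) (frame e y)].

Definition tbun M : bundle M :=
  Bundle (fun x (X : vfield M) => smooth_near (chart_at x x) (vf_coord X x)).

(* Sections of f^*B are locally C^oo(M)-combinations of sections t o f. *)
Definition pull M N (f : M -> N) (B : bundle N) : bundle M :=
  @Bundle R M (fun x => B (f x)) (fun x s =>
    exists (m : nat) (t : 'I_m -> section B) (g : 'I_m -> M -> R),
      [/\ (forall j, smooth_at (f x) (t j)), (forall j, smooth_fun_at x (g j)) &
          \forall y \near x, s y = \sum_(j < m) g j y *: t j (f y)]).

Definition subbun M (B : bundle M) (L : forall x, {vspace B x}) : bundle M :=
  @Bundle R M (fun x => subvs_of (L x)) (fun x s =>
    smooth_at x (fun y => vsval (s y) : B y)).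

(* For subspaces V <= U, the quotient U / V is modelled on the complement
   [U :\: V] of V in U, the canonical map U -> U / V being the projection
   along V.  The choice of complement does not vary smoothly with the point;
   smoothness of a section of U / V means that it lifts to a smooth section
   of U. *)
Definition qproj M (B : bundle M) (U V : forall x, {vspace B x}) (x : M) :
    'Hom(B x, subvs_of (U x :\: V x)) :=
  (linfun (vsproj (U x :\: V x)) \o addv_pi1 (U x) (V x))%VF.

Definition quotbun M (B : bundle M) (U V : forall x, {vspace B x}) : bundle M :=
  @Bundle R M (fun x => subvs_of (U x :\: V x)) (fun x s =>
    exists2 t : section B, smooth_at x t &
      \forall y \near x, t y \in U y /\ s y = qproj U V y (t y)).

(* Sections over U \subset M whose restriction to i : N -> M lies in L. *)
Definition secs_along M N (i : N -> M) (B : bundle M)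
    (L : forall x : N, {vspace B (i x)}) (U : set M) (s : section B) : Prop :=
  secs U s /\ forall x, U (i x) -> s (i x) \in L x.

(* Vector fields on U \subset M whose restriction to i : N -> M lies in F. *)
Definition vf_along M N (i : N -> M) (F : forall x : N, {vspace tangent x})
    (U : set M) (X : section (tbun M)) : Prop :=
  secs U X /\ forall x, U (i x) -> exists2 v, v \in F x & X (i x) = tmap i x v.

Definition involutive M (F : forall x : M, {vspace tangent x}) : Prop :=
  forall (U : set M) (X Y : section (tbun M)), open U ->
    subsecs (B := tbun M) F U X -> subsecs (B := tbun M) F U Y ->
    subsecs (B := tbun M) F U (lie X Y).

Definition connection_op M (A : bundle M) := vfield M -> section A -> section A.

(* A flat F-connection on A, as a morphism of sheaves
   \Gamma_F x \Gamma_A -> \Gamma_A. *)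
Definition flat_Fconnection M (F : forall x : M, {vspace tangent x})
    (A : bundle M) (nab : connection_op A) : Prop :=
  forall U : set M, open U ->
  let vfs := subsecs (B := tbun M) F U in
  [/\ (forall Y s, vfs Y -> secs U s -> secs U (nab Y s)),
      (forall Y Y' s s', vfs Y -> vfs Y' -> secs U s -> secs U s' ->
        (forall x, U x -> Y x = Y' x /\ s x = s' x) ->
        forall x, U x -> nab Y s x = nab Y' s' x),
      (forall f Y Y' s, smooth_fun_on U f -> vfs Y -> vfs Y' -> secs U s ->
        forall x, U x ->
        nab (fun y => f y *: Y y + Y' y) s x = f x *: nab Y s x + nab Y' s x),
      (forall f Y s s', smooth_fun_on U f -> vfs Y -> secs U s -> secs U s' ->
        forall x, U x ->
        nab Y (fun y => f y *: s y + s' y) x =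
          f x *: nab Y s x + dirder x (Y x) f *: s x + nab Y s' x) &
      (forall Y Z s, vfs Y -> vfs Z -> secs U s -> forall x, U x ->
        nab Y (nab Z s) x - nab Z (nab Y s) x = nab (lie Y Z) s x)].

Definition flat_secs M (F : forall x : M, {vspace tangent x})
    (A : bundle M) (nab : connection_op A) (U : set M) (s : section A) : Prop :=
  secs U s /\
  forall (V : set M) Y, open V -> V `<=` U -> subsecs (B := tbun M) F V Y ->
    forall x, V x -> nab Y s x = 0.

Definition invariant_under M (F : forall x : M, {vspace tangent x})
    (A : bundle M) (nab : connection_op A) (L : forall x, {vspace A x}) : Prop :=
  forall (U : set M) Y s, open U -> subsecs (B := tbun M) F U Y ->
    subsecs L U s -> subsecs L U (nab Y s).

(* The connection induced on an invariant subbundle. *)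
Definition sub_connection M (A : bundle M) (nab : connection_op A)
    (L : forall x, {vspace A x}) : connection_op (subbun L) :=
  fun Y s x => vsproj (L x) (nab Y (fun y => vsval (s y) : A y) x).

Definition simple_foliation N N' (F : forall x : N, {vspace tangent x})
    (p : N -> N') : Prop :=
  [/\ smooth_map p, (forall y, exists x, p x = y),
      (forall x (w : tangent (p x)), exists v, tmap p x v = w),
      (forall y, connected (p @^-1` [set y])) &
      forall x (v : tangent x), v \in F x <-> tmap p x v = 0].

(* A' -> N' is the quotient of A -> N with respect to ker dp and nab: [phi]
   is an isomorphism from A to p^*A', and p^# : t |-> phi^{-1} (t o p) is an
   isomorphism from the sheaf of sections of A' onto p_* of the sheaf of flat
   sections of A.  Existence of such A' is the triviality of the holonomy. *)
Definition is_quotient N N' (p : N -> N') (F : forall x : N, {vspace tangent x})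
    (A : bundle N) (nab : connection_op A) (A' : bundle N')
    (phi : forall x, 'Hom(A x, A' (p x))) : Prop :=
  [/\ is_vbundle A', (forall x, bijective (phi x)),
      (forall x (s : section A),
        smooth_at x s <-> smooth_at (b := pull p A') x (fun y => phi y (s y))),
      (forall (V : set N') (t : section A') (s : section A), open V -> secs V t ->
        (forall x, V (p x) -> phi x (s x) = t (p x)) ->
        flat_secs F nab (p @^-1` V) s) &
      (forall (V : set N') (s : section A), open V ->
        flat_secs F nab (p @^-1` V) s ->
        exists2 t : section A', secs V t &
          forall x, V (p x) -> phi x (s x) = t (p x))].

(* The restriction of [phi] to subbundles it maps into one another. *)
Definition sub_hom N N' (p : N -> N') (A : bundle N) (A' : bundle N')
    (phi : forall x, 'Hom(A x, A' (p x)))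
    (L : forall x, {vspace A x}) (L' : forall y, {vspace A' y}) (x : N) :
    'Hom(subbun L x, subbun L' (p x)) :=
  linfun (fun u : subvs_of (L x) => vsproj (L' (p x)) (phi x (vsval u))).

End Bundles.

Arguments qproj {R M B} U V x.

(* The bracket is a morphism of sheaves \Gamma_E x \Gamma_E -> \Gamma_E; the
   axioms are imposed over every open set. *)
Record courant (R : realType) (M : manifold R) := Courant {
  cbun :> bundle M;
  cform : forall x, {symmetric (cbun x)};
  anchor : forall x, 'Hom(cbun x, tangent x);
  cbrk : section cbun -> section cbun -> section cbun;
  c_vbundle : is_vbundle cbun;
  c_nondegenerate : forall x, nondegenerate (cform x);
  cform_smooth : forall x (e1 e2 : section cbun), smooth_at x e1 -> smooth_at x e2 ->
    smooth_fun_at x (fun y => cform y (e1 y) (e2 y));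
  anchor_smooth : forall x (e : section cbun), smooth_at x e ->
    smooth_at (b := tbun M) x (fun y => anchor y (e y));
  cbrk_smooth : forall U e1 e2, open U -> secs U e1 -> secs U e2 ->
    secs U (cbrk e1 e2);
  cbrk_local : forall U e1 e2 e1' e2', open U ->
    secs U e1 -> secs U e2 -> secs U e1' -> secs U e2' ->
    (forall x, U x -> e1 x = e1' x /\ e2 x = e2' x) ->
    forall x, U x -> cbrk e1 e2 x = cbrk e1' e2' x;
  cbrk_linear_l : forall U (a : R) e1 e1' e2, open U ->
    secs U e1 -> secs U e1' -> secs U e2 -> forall x, U x ->
    cbrk (fun y => a *: e1 y + e1' y) e2 x = a *: cbrk e1 e2 x + cbrk e1' e2 x;
  cbrk_linear_r : forall U (a : R) e1 e2 e2', open U ->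
    secs U e1 -> secs U e2 -> secs U e2' -> forall x, U x ->
    cbrk e1 (fun y => a *: e2 y + e2' y) x = a *: cbrk e1 e2 x + cbrk e1 e2' x;
  c_jacobi : forall U e1 e2 e3, open U ->
    secs U e1 -> secs U e2 -> secs U e3 -> forall x, U x ->
    cbrk e1 (cbrk e2 e3) x = cbrk (cbrk e1 e2) e3 x + cbrk e2 (cbrk e1 e3) x;
  c_leibniz : forall U f e1 e2, open U ->
    smooth_fun_on U f -> secs U e1 -> secs U e2 -> forall x, U x ->
    cbrk e1 (fun y => f y *: e2 y) x =
      f x *: cbrk e1 e2 x + dirder x (anchor x (e1 x)) f *: e2 x;
  c_invariant : forall U e1 e2 e3, open U ->
    secs U e1 -> secs U e2 -> secs U e3 -> forall x, U x ->
    dirder x (anchor x (e1 x)) (fun y => cform y (e2 y) (e3 y)) =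
      cform x (cbrk e1 e2 x) (e3 x) + cform x (e2 x) (cbrk e1 e3 x);
  c_anchor_brk : forall U e1 e2, open U -> secs U e1 -> secs U e2 ->
    forall x, U x ->
    anchor x (cbrk e1 e2 x) =
      lie (fun y => anchor y (e1 y)) (fun y => anchor y (e2 y)) x;
  c_symmetric_part : forall U e1 e2, open U -> secs U e1 -> secs U e2 ->
    forall x, U x ->
    cform x (e1 x) (cbrk e2 e2 x) =
      2^-1 * dirder x (anchor x (e1 x)) (fun y => cform y (e2 y) (e2 y)) }.

Arguments cform {R M} c x.
Arguments anchor {R M} c x.
Arguments cbrk {R M} c _ _ _.

Section Reduction.
Context {R : realType}.
Implicit Types M N S : manifold R.

(* [L] is indexed by the points of M, but only its values on the submanifold
   i : S -> M are used. *)
Definition is_dirac M (E : courant M) S (i : S -> M) (L : forall x, {vspace E x}) : Prop :=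
  [/\ is_subbundle (B := pull i E) (fun x => L (i x)),
      (forall x, L (i x) = orthov (cform E (i x)) (L (i x))),
      (forall x e, e \in L (i x) -> exists v, anchor E (i x) e = tmap i x v) &
      (forall e1 e2 : section E, secs setT e1 -> secs setT e2 ->
        (forall x, e1 (i x) \in L (i x)) -> (forall x, e2 (i x) \in L (i x)) ->
        forall x, cbrk E e1 e2 (i x) \in L (i x))].

Variables (M N : manifold R) (E : courant M) (i : N -> M).
Variables (K : forall x : N, {vspace E (i x)}) (F : forall x : N, {vspace tangent x}).

Definition perp (x : N) : {vspace E (i x)} := orthov (cform E (i x)) (K x).

Definition Equot : bundle N := quotbun (B := pull i E) perp K.

Definition qclass (x : N) : 'Hom(E (i x), Equot x) := qproj (B := pull i E) perp K x.

(* A class in K^\perp / K is represented by its own underlying vector. *)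
Definition qform (x : N) (a b : Equot x) : R := cform E (i x) (vsval a) (vsval b).

Variable nab : connection_op Equot.

Definition geometric_coisotropic_data : Prop :=
  [/\ embedding i,
      is_subbundle (B := pull i E) K /\ (forall x, (K x <= perp x)%VS),
      is_subbundle (B := tbun N) F /\ involutive F,
      flat_Fconnection F nab &
      forall U Y (s1 s2 : section Equot), open U -> subsecs (B := tbun N) F U Y ->
        secs U s1 -> secs U s2 -> forall x, U x ->
        dirder x (Y x) (fun y => qform (s1 y) (s2 y)) =
          qform (nab Y s1 x) (s2 x) + qform (s1 x) (nab Y s2 x)].

Definition flat_along (U : set M) (e : section E) : Prop :=
  secs_along perp U e /\
  flat_secs F nab (i @^-1` U) (fun x => qclass x (e (i x))).

Definition reducible : Prop :=
  [/\ (forall x e, e \in perp x -> exists v, anchor E (i x) e = tmap i x v),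
      (forall x e, e \in K x ->
        exists2 v, v \in F x & anchor E (i x) e = tmap i x v),
      (forall U e X, open U -> flat_along U e -> vf_along i F U X ->
        vf_along i F U (lie (fun y => anchor E y (e y)) X)) &
      (forall U e1 e2, open U -> flat_along U e1 -> flat_along U e2 ->
        flat_along U (cbrk E e1 e2))].

Variables (N' : manifold R) (p : N -> N') (E' : courant N').
Variable phi : forall x, 'Hom(Equot x, E' (p x)).

(* The Courant algebroid structure of [E'] is the one induced from [E] on the
   quotient of [Equot]. *)
Definition is_reduced_courant : Prop :=
  [/\ (forall x a b, cform E' (p x) (phi x a) (phi x b) = qform a b),
      (forall x e v, e \in perp x -> anchor E (i x) e = tmap i x v ->
        anchor E' (p x) (phi x (qclass x e)) = tmap p x v) &
      (forall (U : set M) (V : set N') (e1 e2 : section E) (t1 t2 : section E'),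
        open U -> open V -> flat_along U e1 -> flat_along U e2 ->
        secs V t1 -> secs V t2 ->
        (forall x, U (i x) -> V (p x) ->
          phi x (qclass x (e1 (i x))) = t1 (p x) /\
          phi x (qclass x (e2 (i x))) = t2 (p x)) ->
        forall x, U (i x) -> V (p x) ->
          phi x (qclass x (cbrk E e1 e2 (i x))) = cbrk E' t1 t2 (p x))].

Variable L : forall x, {vspace E x}.

Definition Lquot (x : N) : {vspace Equot x} :=
  (qclass x @: ((perp x :&: L (i x)) + K x))%VS.

End Reduction.

(* Main.v *)
(* The naive route transports L_quot along the fibres of p.  Instead, choose a
   local frame of E_red on V and let P(x), for x in p^{-1}(V), be the matrix of
   the Euclidean orthogonal projection, in that frame, onto the image of
   L_quot at x.  The frame sections pull back to flat sections of E_quot, so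
   invariance of L_quot under nabla says that Y(P) (1 - P) = 0 for Y in F; as P
   is a symmetric idempotent this forces Y(P) = 0.  Hence the rows of P are flat
   sections over all of p^{-1}(V), and they descend by the definition of the
   quotient: P = P' o p with P' smooth, which defines L_red as a smooth field of
   subspaces.  Smoothness of P comes from (a): K^perp /\ L = (K + L)^perp has
   constant rank.

   For the bracket, a section of L_red lifts to a section of K^perp /\ L over N;
   its coefficients in a frame of L extend from N to M, and that frame extends
   from S to M, because a function on an embedded submanifold extends locally
   (inverse function theorem).  A bump function makes the lift global, so the
   Dirac condition for L applies to it. *)
From HB Require Import structures.
Require Import Defs.
From mathcomp Require Import all_boot all_order all_algebra.
From mathcomp Require Import sesquilinear.
From mathcomp Require Import all_classical all_reals all_analysis.
From mathcomp Require Import ring lra.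

Set Implicit Arguments.
Unset Strict Implicit.
Unset Printing Implicit Defensive.

Import Order.TTheory GRing.Theory Num.Theory.
Import numFieldNormedType.Exports.

Local Open Scope classical_set_scope.
Local Open Scope ring_scope.

(** * Smooth maps between Euclidean spaces *)

Section Differentiability.
Context {R : realType}.

(** Frames of L_quot exist only locally on N, and gluing them along a fibre would require paths and
    parallel transport. The matrix of an orthogonal projector depends on the subspace alone, so it
    is defined on all of p^{-1}(V) at once, and local frames serve only to check its smoothness.
    Constancy along whole fibres is supplied by the descent clause of [is_quotient]. The Euclidean
    structure comes from the frame and is unrelated to the pairing, which vanishes on a lagrangian
    subspace and so gives no orthogonal projector onto it. The pairing instead fixes the rank: the
    image of L_quot is lagrangian in each fibre, so P has half the rank of E_red everywhere. For the
    bracket two demands compete. A lift must be flat along N to compute the reduced bracket, and it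
    must be global with values in L along all of S for the Dirac condition. A cut-off achieves
    globality but in general destroys flatness, so the uncut and the cut-off lifts are both kept,
    and locality identifies their brackets at the point where the bump function is 1 nearby. *)

Lemma differentiable_epsP (V W : normedModType R) (f : V -> W) x (L : {linear V -> W}) :
  continuous L ->
  (forall e, 0 < e -> \forall h \near 0, `|f (h + x) - f x - L h| <= e * `|h|) ->
  differentiable f x /\ 'd f x = L :> (V -> W).
Proof.
move=> cL H.
have E : f \o shift x = cst (f x) + L +o_ 0 id.
  apply/(@eqaddoP _ _ _ _ _ _ _ id) => e e0; apply: filterS (H e e0) => h.
  rewrite !fctE /=.
  by rewrite opprD addrA.
have gd : 'd f x = L :> (V -> W) by apply: diff_unique.
by split=> //; apply/diff_locallyP; rewrite gd.
Qed.

Lemma differentiable_eps (V W : normedModType R) (f : V -> W) x :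
  differentiable f x -> forall e, 0 < e ->
  \forall h \near 0, `|f (h + x) - f x - 'd f x h| <= e * `|h|.
Proof.
move=> /diff_locally/(@eqaddoP _ _ _ _ _ _ _ id) H e e0.
apply: filterS (H e e0) => h; rewrite !fctE /=.
by rewrite opprD addrA.
Qed.

End Differentiability.

Lemma continuous_sum_ord {R : realType} (T : topologicalType) (W : normedModType R)
    m (f : 'I_m -> T -> W) (x : T) :
  (forall j, {for x, continuous (f j)}) ->
  {for x, continuous (fun y => \sum_j f j y)}.
Proof.
move=> cf; suff E s : {for x, continuous (fun y => \sum_(j <- s) f j y)}.
  exact: E.
elim: s => [|j s IH].
  have -> : (fun y => \sum_(j <- [::]) f j y) = fun=> 0.
    by apply/funext => y; rewrite big_nil.
  exact: cst_continuous.
have -> : (fun y => \sum_(j <- j :: s) f j y) = f j \+ (fun y => \sum_(j <- s) f j y).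
  by apply/funext => y; rewrite big_cons.
exact: continuousD.
Qed.

Section Calculus.
Context {R : realType} {n : nat}.
Implicit Types (U : set 'rV[R]_n) (x v : 'rV[R]_n).

Lemma diff_near_eq (W : normedModType R) (f g : 'rV[R]_n -> W) x :
  {near x, f =1 g} -> differentiable f x ->
  differentiable g x /\ 'd g x = 'd f x :> ('rV[R]_n -> W).
Proof.
move=> fg df; have fgx : f x = g x by exact: nbhs_singleton fg.
apply: differentiable_epsP => [|e e0]; first exact: diff_continuous.
have {}fg : \forall h \near (0 : 'rV[R]_n), f (h + x) = g (h + x).
  by move/nbhs0P: fg; apply: filterS => h /=; rewrite [x + h]addrC.
near=> h; rewrite -fgx.
have <- : f (h + x) = g (h + x) by near: h.
by near: h; exact: (differentiable_eps df e0).
Unshelve. all: by end_near. Qed.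

Lemma open_near_eq (T : topologicalType) (V : set T) (W : Type) (f g : T -> W) (x : T) :
  open V -> V x -> {in V, f =1 g} -> {near x, f =1 g}.
Proof.
move=> oV Vx fg; apply: (filterS _ (open_nbhs_nbhs (conj oV Vx))) => y Vy.
by apply: fg; rewrite inE.
Qed.

(** Formulas for derivatives hold only at points of U, so the inductions on k below replace a
    derivative by its formula through this lemma. Openness of U lets agreement on U pass to
    derivatives. *)
Lemma Ck_ext (W : normedModType R) k U (f g : 'rV[R]_n -> W) :
  open U -> {in U, f =1 g} -> Ck k U f -> Ck k U g.
Proof.
move=> oU; elim: k f g => [|k IH] f g fg /=.
  move=> cf x Ux; have fgx := open_near_eq oU Ux fg.
  rewrite /prop_for /continuous_at -(nbhs_singleton fgx).
  apply: cvg_trans (cf x Ux); apply: (@near_eq_cvg _ _ (nbhs x)).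
  exact: fgx.
move=> [df cdf]; split=> [x Ux|v].
  by have [] := diff_near_eq (open_near_eq oU Ux fg) (df x Ux).
apply: IH (cdf v) => x; rewrite inE => Ux.
have [_ E] := diff_near_eq (open_near_eq oU Ux fg) (df x Ux).
exact: (esym (congr1 (@^~ v) E)).
Qed.

Lemma Ck_sub (W : normedModType R) k U V (f : 'rV[R]_n -> W) :
  V `<=` U -> Ck k U f -> Ck k V f.
Proof.
move=> VU; elim: k f => [|k IH] f /=; first by move=> cf x /VU; exact: cf.
by move=> [df cdf]; split=> [x /VU|v]; [exact: df|exact: IH].
Qed.

Lemma CkW (W : normedModType R) k U (f : 'rV[R]_n -> W) :
  Ck k.+1 U f -> Ck k U f.
Proof.
elim: k f => [|k IH] f /= [df cdf].
  by move=> x Ux; apply: differentiable_continuous; exact: df.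
by split=> // v; apply: IH; exact: cdf.
Qed.

Lemma Ck_cst (W : normedModType R) k U (a : W) : Ck k U (fun=> a).
Proof.
elim: k a => [|k IH] a /=; first by move=> x _; exact: cst_continuous.
split=> [x _|v]; first exact: differentiable_cst.
have -> : (fun x => 'd (fun=> a) x v) = (fun=> 0); last exact: IH.
by apply/funext => x; rewrite diff_cst.
Qed.

Lemma CkD (W : normedModType R) k U (f g : 'rV[R]_n -> W) :
  open U -> Ck k U f -> Ck k U g -> Ck k U (fun x => f x + g x).
Proof.
move=> oU; elim: k f g => [|k IH] f g /=.
  by move=> cf cg x Ux; apply: continuousD; [exact: cf|exact: cg].
move=> [df cdf] [dg cdg]; split=> [x Ux|v].
  by apply: differentiableD; [exact: df|exact: dg].
apply: Ck_ext oU _ (IH _ _ (cdf v) (cdg v)) => x; rewrite inE => Ux.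
by rewrite [in RHS]diffD; [|exact: df|exact: dg].
Qed.

Lemma CkM k U (f g : 'rV[R]_n -> R) :
  open U -> Ck k U f -> Ck k U g -> Ck k U (fun x => f x * g x).
Proof.
move=> oU; elim: k f g => [|k IH] f g.
  by move=> cf cg x Ux; apply: continuousM; [exact: cf|exact: cg].
move=> cf cg; have [df cdf] := cf; have [dg cdg] := cg; split=> [x Ux|v].
  by apply: differentiableM; [exact: df|exact: dg].
apply: Ck_ext oU _ (CkD oU (IH _ _ (CkW cf) (cdg v)) (IH _ _ (CkW cg) (cdf v))).
by move=> x; rewrite inE => Ux; rewrite [in RHS]diffM; [|exact: df|exact: dg].
Qed.

Lemma CkV k U (f : 'rV[R]_n -> R) :
  open U -> (forall x, U x -> f x != 0) -> Ck k U f -> Ck k U (fun x => (f x)^-1).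
Proof.
move=> oU f0; elim: k => [|k IH].
  by move=> cf x Ux; apply: continuousV; [exact: f0|exact: cf].
move=> cf; have [df cdf] := cf; split=> [x Ux|v].
  by apply: differentiableV; [exact: df|exact: f0].
(* The derivative of 1/f is -(1/f)^2 df, a polynomial in df and 1/f itself, so regularity of 1/f of
   one order less suffices. *)
have cV := IH (CkW cf).
have cm : Ck k U (fun x => -1 * ((f x)^-1 * (f x)^-1) * 'd f x v).
  by do 2?[apply: CkM => //]; [exact: Ck_cst|exact: CkM|exact: cdf].
apply: Ck_ext oU _ cm =>  x; rewrite inE => Ux; rewrite diffV; [|exact: df|exact: f0].
by rewrite /= mulN1r -invfM -expr2.
Qed.

Lemma Ck_sum k U m (f : 'I_m -> 'rV[R]_n -> R) :
  open U -> (forall j, Ck k U (f j)) -> Ck k U (fun x => \sum_j f j x).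
Proof.
move=> oU cf; have E s : Ck k U (fun x => \sum_(j <- s) f j x).
  elim: s => [|j s IH].
    under eq_fun do rewrite big_nil.
    exact: Ck_cst.
  under eq_fun do rewrite big_cons.
  exact: CkD.
exact: E.
Qed.

Definition coordl m (j : 'I_m) (u : 'rV[R]_m) : R := u 0 j.

Lemma coordl_linear m (j : 'I_m) : linear (coordl j).
Proof. by move=> a u v; rewrite /coordl !mxE. Qed.
HB.instance Definition _ m (j : 'I_m) :=
  GRing.isLinear.Build _ _ _ _ (@coordl m j) (coordl_linear j).

Lemma diff_coord (V : normedModType R) m (f : V -> 'rV[R]_m) (x v : V) (j : 'I_m) :
  differentiable f x -> 'd (fun y => f y 0 j) x v = 'd f x v 0 j.
Proof.
move=> df; have -> : (fun y => f y 0 j) = coordl j \o f by [].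
have cc : continuous (@coordl m j) by move=> z; exact: coord_continuous.
rewrite diff_comp //; last exact: linear_differentiable.
by rewrite /= diff_lin.
Qed.

Lemma differentiable_rV m (f : 'rV[R]_n -> 'rV[R]_m) x :
  differentiable f x <-> forall j, differentiable (fun y => f y 0 j) x.
Proof.
split=> [df j|df].
  have -> : (fun y => f y 0 j) = coordl j \o f by [].
  have cc : continuous (@coordl m j) by move=> z; exact: coord_continuous.
  by apply: differentiable_comp => //; exact: linear_differentiable.
have -> : f = \sum_j (fun y => f y 0 j *: delta_mx 0 j).
  apply/funext => y; rewrite fct_sumE.
  by rewrite [LHS]row_sum_delta.
by apply: differentiable_sum => j; exact: differentiableZl.
Qed.

Lemma continuous_rV (T : topologicalType) m (f : T -> 'rV[R]_m) (x : T) :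
  {for x, continuous f} <-> forall j, {for x, continuous (fun y => f y 0 j)}.
Proof.
split=> [cf j|cf].
  have cc := @coord_continuous R 1 m 0 j (f x).
  exact: (@cvg_comp _ _ _ f (fun u : 'rV_m => u 0 j) _ _ _ cf cc).
have -> : f = fun y => \sum_j (f y 0 j *: delta_mx 0 j).
  by apply/funext => y; rewrite [LHS]row_sum_delta.
apply: continuous_sum_ord => j; apply: cvgZr_tmp; exact: cf.
Qed.

Lemma Ck_rV k U m (f : 'rV[R]_n -> 'rV[R]_m) :
  open U -> Ck k U f <-> forall j, Ck k U (fun y => f y 0 j).
Proof.
move=> oU; elim: k f => [|k IH] f.
  split=> [cf j x Ux|cf x Ux].
    by apply: (continuous_rV f x).1; exact: cf.
  by apply/continuous_rV => j; exact: cf.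
split=> [[df cdf] j|cf].
  split=> [x Ux|v]; first by apply: (differentiable_rV f x).1; exact: df.
  apply: Ck_ext oU _ ((IH _).1 (cdf v) j) => x; rewrite inE => Ux.
  by rewrite diff_coord //; exact: df.
have df x : U x -> differentiable f x.
  by move=> Ux; apply/differentiable_rV => j; have [+ _] := cf j; exact.
split=> // v; apply/IH => j; have [_ /(_ v)] := cf j.
apply: Ck_ext oU _ => x; rewrite inE => Ux.
by rewrite diff_coord //; exact: df.
Qed.

End Calculus.

Section Composition.
Context {R : realType}.

Lemma Ck_comp_scalar n m k (U : set 'rV[R]_n) (V : set 'rV[R]_m)
    (f : 'rV[R]_n -> 'rV[R]_m) (g : 'rV[R]_m -> R) :
  open U -> open V -> (forall x, U x -> V (f x)) ->
  Ck k U f -> Ck k V g -> Ck k U (g \o f).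
Proof.
move=> oU oV fUV; elim: k g => [|k IH] g.
  by move=> cf cg x Ux; apply: continuous_comp; [exact: cf|apply: cg; exact: fUV].
move=> cf cg; have [df cdf] := cf; have [dg cdg] := cg; split=> [x Ux|v].
  by apply: differentiable_comp; [exact: df|apply: dg; exact: fUV].
(* The chain rule in coordinates: the second factors are partial derivatives of g composed with f,
   to which the induction hypothesis applies. *)
have cs : Ck k U (fun x => \sum_j
    'd f x v 0 j * ('d g (f x) (delta_mx 0 j))).
  apply: Ck_sum => // j; apply: CkM => //; first by move/(Ck_rV _ _ oU): (cdf v).
  exact: IH _ (CkW cf) (cdg _).
apply: Ck_ext oU _ cs => x; rewrite inE => Ux.
rewrite (diff_comp (df x Ux) (dg (f x) (fUV x Ux))) /=.
rewrite [X in _ = 'd g (f x) X]row_sum_delta linear_sum.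
by apply: eq_bigr => j _; rewrite linearZ.
Qed.

Lemma Ck_linear n m k U (f : {linear 'rV[R]_n -> 'rV[R]_m}) :
  open U -> Ck k U f.
Proof.
move=> oU; have cf : continuous f.
  have -> : f = (fun u : 'rV[R]_n => \sum_j (u 0 j *: f (delta_mx 0 j))) :> (_ -> _).
    apply/funext => u; rewrite [X in f X]row_sum_delta linear_sum.
    by apply: eq_bigr => j _; rewrite linearZ.
  move=> u; apply: continuous_sum_ord => j.
  apply: differentiable_continuous; apply: differentiableZl.
  exact: differentiable_coord.
case: k => [|k]; first by move=> x _; exact: cf.
split=> [x _|v]; first exact: linear_differentiable.
under eq_fun do rewrite diff_lin //.
exact: Ck_cst.
Qed.

End Composition.

Section SmoothNear.
Context {R : realType} {n : nat}.
Implicit Types (a : 'rV[R]_n).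

Lemma smooth_near_ext (W : normedModType R) a (f g : 'rV[R]_n -> W) :
  {near a, f =1 g} -> smooth_near a f -> smooth_near a g.
Proof.
rewrite /prop_near1 nbhsE => -[B [oB Ba] fg] [U [oU Ua cf]].
exists (B `&` U); split=> [|//|k]; first exact: openI.
apply: (@Ck_ext _ _ _ _ _ f); first exact: openI.
  by move=> x; rewrite inE => -[Bx _]; exact: fg.
by apply: Ck_sub (cf k) => x [].
Qed.

Lemma smooth_near_nbhs (W : normedModType R) a (f : 'rV[R]_n -> W) :
  smooth_near a f -> \forall b \near a, smooth_near b f.
Proof.
move=> [U [oU Ua cf]]; apply: (filterS _ (open_nbhs_nbhs (conj oU Ua))).
by move=> b Ub; exists U.
Qed.

Lemma smooth_near_continuous (W : normedModType R) a (f : 'rV[R]_n -> W) :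
  smooth_near a f -> {for a, continuous f}.
Proof. by move=> [U [oU Ua cf]]; exact: (cf 0%N). Qed.

Lemma smooth_near_differentiable (W : normedModType R) a (f : 'rV[R]_n -> W) :
  smooth_near a f -> differentiable f a.
Proof. by move=> [U [oU Ua cf]]; have [df _] := cf 1%N; exact: df. Qed.

Lemma smooth_near_cst (W : normedModType R) a (w : W) : smooth_near a (fun=> w).
Proof. by exists setT; split=> // [|k]; [exact: openT|exact: Ck_cst]. Qed.

Lemma smooth_near2 (W1 W2 W : normedModType R) (op : W1 -> W2 -> W) a
    (f : 'rV[R]_n -> W1) (g : 'rV[R]_n -> W2) :
  (forall U k, open U -> Ck k U f -> Ck k U g -> Ck k U (fun x => op (f x) (g x))) ->
  smooth_near a f -> smooth_near a g -> smooth_near a (fun x => op (f x) (g x)).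
Proof.
move=> H [U [oU Ua cf]] [V [oV Va cg]].
have oUV := openI oU oV; exists (U `&` V); split=> // k; apply: H => //.
  by apply: Ck_sub (cf k) => x [].
by apply: Ck_sub (cg k) => x [].
Qed.

Lemma smooth_nearD (W : normedModType R) a (f g : 'rV[R]_n -> W) :
  smooth_near a f -> smooth_near a g -> smooth_near a (fun x => f x + g x).
Proof. by apply: smooth_near2 => U k; exact: CkD. Qed.

Lemma smooth_nearM a (f g : 'rV[R]_n -> R) :
  smooth_near a f -> smooth_near a g -> smooth_near a (fun x => f x * g x).
Proof. by apply: (@smooth_near2 R R R) => U k; exact: CkM. Qed.

Lemma open_restr_preimage (T : topologicalType) (W : topologicalType) (f : T -> W)
    (U : set T) (V : set W) :
  open U -> open V -> (forall x, U x -> {for x, continuous f}) ->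
  open (U `&` f @^-1` V).
Proof.
move=> oU oV cf; rewrite openE => x [Ux Vfx]; rewrite /interior.
apply: filterI; first exact: open_nbhs_nbhs.
by apply: (cf x Ux); exact: open_nbhs_nbhs.
Qed.

Lemma smooth_nearV a (f : 'rV[R]_n -> R) :
  f a != 0 -> smooth_near a f -> smooth_near a (fun x => (f x)^-1).
Proof.
move=> fa0 [U [oU Ua cf]].
have oV : open (U `&` f @^-1` [set y | y != 0]).
  exact: (@open_restr_preimage _ R^o f U _ oU (@open_neq _ 0) (cf 0%N)).
exists (U `&` f @^-1` [set y | y != 0]); split=> // k.
apply: CkV => //; first by move=> x [].
by apply: Ck_sub (cf k) => x [].
Qed.

Lemma smooth_near_rV a m (f : 'rV[R]_n -> 'rV[R]_m) :
  smooth_near a f <-> forall j, smooth_near a (fun y => f y 0 j).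
Proof.
split=> [[U [oU Ua cf]] j|cf].
  by exists U; split=> // k; move/(Ck_rV _ _ oU): (cf k).
have [U HU] := choice cf.
have : \forall x \near a, forall j, U j x.
  apply: (@filter_forall _ _ U (nbhs a)) => j.
  by have [oj Uj _] := HU j; exact: open_nbhs_nbhs.
rewrite /prop_near1 nbhsE => -[B [oB Ba] BU]; exists B; split=> // k.
apply/(Ck_rV _ _ oB) => j; have [_ _ cj] := HU j.
by apply: Ck_sub (cj k) => x /BU.
Qed.

Lemma smooth_near_linear a m (f : {linear 'rV[R]_n -> 'rV[R]_m}) :
  smooth_near a f.
Proof. by exists setT; split=> // [|k]; [exact: openT|apply: Ck_linear; exact: openT]. Qed.

End SmoothNear.

Section SmoothNearComp.
Context {R : realType}.

Lemma smooth_near_comp_scalar n m (a : 'rV[R]_n) (f : 'rV[R]_n -> 'rV[R]_m)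
    (g : 'rV[R]_m -> R) :
  smooth_near a f -> smooth_near (f a) g -> smooth_near a (g \o f).
Proof.
move=> [U [oU Ua cf]] [V [oV Va cg]].
have oUV : open (U `&` f @^-1` V).
  by apply: open_restr_preimage => //; exact: (cf 0%N).
exists (U `&` f @^-1` V); split=> // k.
apply: (@Ck_comp_scalar R n m k _ V) => //; first by move=> x [].
by apply: Ck_sub (cf k) => x [].
Qed.

Lemma smooth_near_comp n m l (a : 'rV[R]_n) (f : 'rV[R]_n -> 'rV[R]_m)
    (g : 'rV[R]_m -> 'rV[R]_l) :
  smooth_near a f -> smooth_near (f a) g -> smooth_near a (g \o f).
Proof.
move=> sf /smooth_near_rV sg; apply/smooth_near_rV => j.
exact: smooth_near_comp_scalar sf (sg j).
Qed.

End SmoothNearComp.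

(** * Smooth functions on manifolds *)

Section ManifoldFunctions.
Context {R : realType}.
Implicit Types M N : manifold R.

Lemma cdom_nbhs (T : topologicalType) n (c : chart R T n) x :
  cdom c x -> \forall y \near x, cdom c y.
Proof. by move=> cx; apply: open_nbhs_nbhs; split=> //; exact: cdom_open. Qed.

Lemma cimg_nbhs (T : topologicalType) n (c : chart R T n) x :
  cdom c x -> \forall z \near c x, cdom c (cinv c z) /\ c (cinv c z) = z.
Proof.
move=> cx; have : nbhs (c x) (c @` cdom c).
  by apply: open_nbhs_nbhs; split; [exact: cimg_open|exists x].
by apply: filterS => _ [y cy <-]; rewrite ctoK.
Qed.

Lemma cinv_continuous_at (T : topologicalType) n (c : chart R T n) x :
  cdom c x -> cinv c @ c x --> x.
Proof.
move=> cx; have : {for c x, continuous (cinv c)}.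
  by apply: cinv_continuous; exists x.
by rewrite /prop_for /continuous_at ctoK.
Qed.

Lemma near_cinv (T : topologicalType) n (c : chart R T n) x (P : T -> Prop) :
  cdom c x -> (\forall y \near x, P y) -> \forall z \near c x, P (cinv c z).
Proof. by move=> cx Px; exact: (cinv_continuous_at cx). Qed.

Lemma smooth_chart_change M (f : M -> R) (x y z : M) :
  cdom (chart_at x) z -> cdom (chart_at y) z ->
  smooth_near (chart_at x z) (f \o cinv (chart_at x)) ->
  smooth_near (chart_at y z) (f \o cinv (chart_at y)).
Proof.
move=> xz yz sf.
have := @smooth_near_comp_scalar _ _ _ _ _ (f \o cinv (chart_at x))
  (chart_compat yz xz).
rewrite /= ctoK // => /(_ sf); apply: smooth_near_ext.
have := near_cinv yz (cdom_nbhs xz); apply: filterS => w /= cw.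
by rewrite ctoK.
Qed.

(** The chart in [smooth_fun_at] changes with the point; here one fixed chart can serve a whole
    neighbourhood. *)
Lemma smooth_fun_at_chart M (f : M -> R) (x z : M) : cdom (chart_at x) z ->
  smooth_fun_at z f <-> smooth_near (chart_at x z) (f \o cinv (chart_at x)).
Proof.
by move=> xz; split; apply: smooth_chart_change => //; exact: chart_at_dom.
Qed.

Lemma near_chart M (x : M) (P : M -> Prop) :
  (\forall z \near chart_at x x, P (cinv (chart_at x) z)) ->
  \forall y \near x, P y.
Proof.
move=> Pz; have cx := chart_at_dom x.
have := cto_continuous cx Pz; rewrite /= => H.
near=> y; have cy : cdom (chart_at x) y by near: y; exact: cdom_nbhs.
by rewrite -(ctoK cy); near: y.
Unshelve. all: by end_near. Qed.

Lemma smooth_fun_at_near M (x : M) (f : M -> R) :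
  smooth_fun_at x f -> \forall y \near x, smooth_fun_at y f.
Proof.
move=> sf; have cx := chart_at_dom x.
apply: near_chart; near=> z.
have [cz ez] : cdom (chart_at x) (cinv (chart_at x) z) /\
    chart_at x (cinv (chart_at x) z) = z by near: z; exact: cimg_nbhs.
apply/(smooth_fun_at_chart _ cz); rewrite ez.
by near: z; exact: smooth_near_nbhs.
Unshelve. all: by end_near. Qed.

Lemma smooth_fun_at_ext M (x : M) (f g : M -> R) :
  {near x, f =1 g} -> smooth_fun_at x f -> smooth_fun_at x g.
Proof.
move=> fg; apply: smooth_near_ext.
exact: (near_cinv (chart_at_dom x) fg).
Qed.

Lemma smooth_fun_at_cst M (x : M) (a : R) : smooth_fun_at x (fun=> a).
Proof. exact: smooth_near_cst. Qed.

Lemma smooth_fun_atD M (x : M) (f g : M -> R) : smooth_fun_at x f ->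
  smooth_fun_at x g -> smooth_fun_at x (fun y => f y + g y).
Proof. exact: smooth_nearD. Qed.

Lemma smooth_fun_atM M (x : M) (f g : M -> R) : smooth_fun_at x f ->
  smooth_fun_at x g -> smooth_fun_at x (fun y => f y * g y).
Proof. exact: smooth_nearM. Qed.

Lemma smooth_fun_atV M (x : M) (f : M -> R) : f x != 0 -> smooth_fun_at x f ->
  smooth_fun_at x (fun y => (f y)^-1).
Proof.
by move=> fx0; apply: smooth_nearV; rewrite /= ctoK //; exact: chart_at_dom.
Qed.

Lemma smooth_fun_at_sum M (x : M) I (s : seq I) (P : pred I) (f : I -> M -> R) :
  (forall j, P j -> smooth_fun_at x (f j)) ->
  smooth_fun_at x (fun y => \sum_(j <- s | P j) f j y).
Proof.
move=> sf; elim: s => [|j s IH].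
  under eq_fun do rewrite big_nil.
  exact: smooth_fun_at_cst.
case: (boolP (P j)) => Pj; last by under eq_fun do rewrite big_cons (negPf Pj).
by under eq_fun do rewrite big_cons Pj; apply: smooth_fun_atD => //; exact: sf.
Qed.

Lemma smooth_fun_at_continuous M (x : M) (f : M -> R) :
  smooth_fun_at x f -> {for x, continuous f}.
Proof.
move=> /smooth_near_continuous; rewrite /prop_for /continuous_at /= => cf A Af.
have cx := chart_at_dom x; apply: near_chart.
by apply: cf; rewrite ctoK.
Qed.

Lemma smooth_map_comp M N (p : M -> N) (x : M) (f : N -> R) :
  smooth_map p -> smooth_fun_at (p x) f -> smooth_fun_at x (f \o p).
Proof.
move=> [cp sp] sf; have cx := chart_at_dom x; have cpx := chart_at_dom (p x).
have := smooth_near_comp_scalar (sp x); rewrite /= ctoK // => /(_ _ sf).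
apply: smooth_near_ext.
have := near_cinv cx (cp x _ (cdom_nbhs cpx)); apply: filterS => y /= py.
by rewrite ctoK.
Qed.

End ManifoldFunctions.

Section Dirder.
Context {R : realType} (M : manifold R).
Implicit Types (x : M) (f g : M -> R).

Lemma dirder_cst x (v : tangent x) (a : R) : dirder x v (fun=> a) = 0.
Proof.
have -> : dirder x v (fun=> a) = 'd (cst a : 'rV[R]_(mdim M) -> R) (chart_at x x) v by [].
by rewrite diff_cst.
Qed.

Lemma dirderD x (v : tangent x) f g : smooth_fun_at x f -> smooth_fun_at x g ->
  dirder x v (fun y => f y + g y) = dirder x v f + dirder x v g.
Proof.
move=> /smooth_near_differentiable sf /smooth_near_differentiable sg.
exact: (congr1 (@^~ v) (diffD sf sg)).
Qed.

Lemma dirderM x (v : tangent x) f g : smooth_fun_at x f -> smooth_fun_at x g ->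
  dirder x v (fun y => f y * g y) = f x * dirder x v g + dirder x v f * g x.
Proof.
move=> /smooth_near_differentiable sf /smooth_near_differentiable sg.
apply: etrans (congr1 (@^~ v) (diffM sf sg)) _; have cx := chart_at_dom x.
by rewrite /= !fctE /= !ctoK //; congr (_ + _); rewrite [RHS]mulrC.
Qed.

Lemma dirder_sum x (v : tangent x) I (s : seq I) (f : I -> M -> R) :
  (forall j, smooth_fun_at x (f j)) ->
  dirder x v (fun y => \sum_(j <- s) f j y) = \sum_(j <- s) dirder x v (f j).
Proof.
move=> sf; elim: s => [|j s IH].
  by under eq_fun do rewrite big_nil; rewrite dirder_cst big_nil.
under eq_fun do rewrite big_cons.
by rewrite dirderD // ?big_cons ?IH //; exact: smooth_fun_at_sum.
Qed.

End Dirder.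

(** Completeness of row vectors in the form in which [banach_fixed_point] asks for it. *)
HB.instance Definition _ (R : realType) n :=
  Uniform_isComplete.Build 'rV[R]_n cauchy_cvg.

(** * The inverse function theorem *)

Section MatrixFunctions.
Variables (T : Type) (R : realType) (P : (T -> R) -> Prop).
Hypothesis Pcst : forall a, P (fun=> a).
Hypothesis PD : forall f g, P f -> P g -> P (fun x => f x + g x).
Hypothesis PM : forall f g, P f -> P g -> P (fun x => f x * g x).

(** [P] stays abstract because it is instantiated twice: by [Ck j V] in the inverse function theorem
    and by [smooth_fun_at x] on manifolds. *)
Definition entrywise m n (A : T -> 'M[R]_(m, n)) := forall i j, P (fun x => A x i j).

Lemma closed_sum I (s : seq I) (f : I -> T -> R) :
  (forall j, P (f j)) -> P (fun x => \sum_(j <- s) f j x).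
Proof.
move=> Pf; elim: s => [|j s IH].
  by under eq_fun do rewrite big_nil; exact: Pcst.
by under eq_fun do rewrite big_cons; exact: PD.
Qed.

Lemma closed_prod I (s : seq I) (f : I -> T -> R) :
  (forall j, P (f j)) -> P (fun x => \prod_(j <- s) f j x).
Proof.
move=> Pf; elim: s => [|j s IH].
  by under eq_fun do rewrite big_nil; exact: Pcst.
by under eq_fun do rewrite big_cons; exact: PM.
Qed.

Lemma entrywise_mul m n p (A : T -> 'M[R]_(m, n)) (B : T -> 'M[R]_(n, p)) :
  entrywise A -> entrywise B -> entrywise (fun x => A x *m B x).
Proof.
by move=> PA PB i j; under eq_fun do rewrite mxE; apply: closed_sum => l; exact: PM.
Qed.

Lemma entrywise_tr m n (A : T -> 'M[R]_(m, n)) :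
  entrywise A -> entrywise (fun x => (A x)^T).
Proof. by move=> PA i j; under eq_fun do rewrite mxE. Qed.

Lemma closed_det n (A : T -> 'M[R]_n) : entrywise A -> P (fun x => \det (A x)).
Proof.
move=> PA; apply: closed_sum => s; apply: PM; first exact: Pcst.
by apply: closed_prod => i; exact: PA.
Qed.

Lemma entrywise_adj n (A : T -> 'M[R]_n) :
  entrywise A -> entrywise (fun x => \adj (A x)).
Proof.
move=> PA i j; under eq_fun do rewrite mxE.
apply: PM; first exact: Pcst.
by apply: closed_det => k l; under eq_fun do rewrite !mxE; exact: PA.
Qed.

(** Cramer's formula stands in for [invmx], which branches on invertibility; only the reciprocal of
    the determinant is not polynomial in the entries. *)
Lemma entrywise_inv n (A : T -> 'M[R]_n) : P (fun x => (\det (A x))^-1) ->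
  entrywise A -> entrywise (fun x => (\det (A x))^-1 *: \adj (A x)).
Proof.
move=> Pd PA i j; under eq_fun do rewrite mxE.
by apply: PM => //; exact: entrywise_adj.
Qed.

End MatrixFunctions.

Section InverseFunction.
Context {R : realType}.

Lemma mx_norm_coord n (u : 'rV[R]_n) j : `|u 0 j| <= `|u|.
Proof.
by rewrite [leRHS]/Num.norm /= mx_normrE; exact: (le_bigmax _ (fun i => `|u i.1 i.2|) (0, j)).
Qed.

Lemma mx_norm_le n (u : 'rV[R]_n) c :
  0 <= c -> (forall j, `|u 0 j| <= c) -> `|u| <= c.
Proof.
move=> c0 uc; rewrite [leLHS]/Num.norm /= mx_normrE; apply/bigmax_leP; split=> //.
by move=> [i j] _ /=; rewrite ord1.
Qed.

Lemma ball_segment n (a z z' : 'rV[R]_n) r t : ball a r z -> ball a r z' ->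
  0 <= t -> t <= 1 -> ball a r (z' + t *: (z - z')).
Proof.
rewrite -!ball_normE /= => az az' t0 t1.
have -> : a - (z' + t *: (z - z')) = t *: (a - z) + (1 - t) *: (a - z').
  by apply/rowP => j; rewrite !mxE; ring.
apply: (le_lt_trans (ler_normD _ _)); rewrite !normrZ !ger0_norm ?subr_ge0 //.
(* The strict inequality comes from the term of weight t, which is lost when t = 0. *)
have [->|tn0] := eqVneq t 0; first by rewrite mul0r add0r subr0 mul1r.
have tp : 0 < t by rewrite lt_neqAle eq_sym tn0.
rewrite (_ : r = t * r + (1 - t) * r); last by ring.
apply: ltr_leD; first by rewrite ltr_pM2l.
by apply: ler_wpM2l; [rewrite subr_ge0|exact: ltW].
Qed.

(** The norm is the maximum norm, so it suffices to apply the scalar mean value theorem to each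
    coordinate of f along the segment from z' to z. *)
Lemma lipschitz_on_ball n m (f : 'rV[R]_n -> 'rV[R]_m) a r c :
  0 <= c ->
  (forall z, ball a r z -> differentiable f z) ->
  (forall z v, ball a r z -> `|'d f z v| <= c * `|v|) ->
  forall z z', ball a r z -> ball a r z' -> `|f z - f z'| <= c * `|z - z'|.
Proof.
move=> c0 df bf z z' az az'; apply: mx_norm_le; first by rewrite mulr_ge0.
move=> j; pose g (t : R) := z' + t *: (z - z').
have dg t : differentiable g t.
  by apply: differentiableD; [exact: differentiable_cst|exact: differentiableZl].
have dgE t : 'd g t 1 = z - z'.
  have gd := is_diffD (is_diff_cst z' t) (is_diff_scalel t (z - z')).
  apply: etrans (congr1 (@^~ 1) (@diff_val _ _ _ _ _ _ _ gd)) _.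
  by rewrite /= !fctE /= add0r scale1r.
pose phi (t : R) := f (g t) 0 j.
have bg t : 0 <= t -> t <= 1 -> ball a r (g t) by exact: ball_segment.
have dfg (t : R) : 0 <= t -> t <= 1 -> differentiable (f \o g) t.
  by move=> t0 t1; apply: differentiable_comp => //; apply: df; exact: bg.
have dphi (t : R) : 0 <= t -> t <= 1 -> is_derive t 1 phi ('d f (g t) (z - z') 0 j).
  move=> t0 t1; have dp : differentiable phi t.
    exact: (differentiable_comp (dfg t t0 t1) (differentiable_coord (f (g t)) 0 j)).
  apply: DeriveDef; first exact/derivable1_diffP.
  rewrite deriveE // (diff_coord _ _ (dfg t t0 t1)) diff_comp //; last exact/df/bg.
  by rewrite /= dgE.
have [t t01 E] : exists2 t, t \in `]0, 1[%R &
    phi 1 - phi 0 = 'd f (g t) (z - z') 0 j * (1 - 0).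
  apply: MVT => // [t|].
    by rewrite in_itv /= => /andP[/ltW t0 /ltW t1]; exact: dphi.
  apply: derivable_within_continuous => t.
  by rewrite in_itv /= => /andP[t0 t1]; have [] := dphi t t0 t1.
move: t01; rewrite in_itv /= => /andP[/ltW t0 /ltW t1].
have -> : (f z - f z') 0 j = phi 1 - phi 0.
  by rewrite /phi /g scale1r scale0r addr0 addrCA subrr addr0 !mxE.
rewrite E subr0 mulr1; apply: le_trans (mx_norm_coord _ _) _.
by apply: bf; exact: bg.
Qed.

(** Since h differs from the identity by a contraction, h z = w is the fixed point equation of z |->
    w - (h z - z). The triangle inequality gives |z - z'| <= 2 |h z - h z'|, hence injectivity and
    the Lipschitz constant 2 of the inverse. *)
Lemma lipschitz_local_inverse n (h : 'rV[R]_n -> 'rV[R]_n) a r :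
  0 < r ->
  (forall z z', ball a r z -> ball a r z' ->
     `|(h z - z) - (h z' - z')| <= 2^-1 * `|z - z'|) ->
  exists k : 'rV[R]_n -> 'rV[R]_n,
    [/\ (forall w, ball (h a) (r / 4) w -> ball a r (k w) /\ h (k w) = w),
        (forall w w', ball (h a) (r / 4) w -> ball (h a) (r / 4) w' ->
           `|k w - k w'| <= 2 * `|w - w'|) &
        (forall z, ball a r z -> ball (h a) (r / 4) (h z) -> k (h z) = z)].
Proof.
move=> r0 hl.
have ba : ball a r a by exact: ballxx.
have r20 : 0 < r / 2 by lra.
have expand z z' : ball a r z -> ball a r z' -> `|z - z'| <= 2 * `|h z - h z'|.
  move=> az az'; have H := hl _ _ az az'.
  have : `|z - z'| <= `|h z - h z'| + 2^-1 * `|z - z'|.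
    apply: le_trans (lerD (lexx _) H).
    have {1}-> : z - z' = (h z - h z') - ((h z - z) - (h z' - z')).
      by apply/rowP => j; rewrite !mxE; ring.
    exact: ler_normB.
  lra.
(* The fixed point lives in the closed ball of radius r/2: closed for completeness, inside the ball
   where h is controlled, and stable because |h a - w| < r/4 and the contraction adds at most
   (1/2)(r/2) = r/4. *)
have cbU z : closed_ball a (r / 2) z -> ball a r z.
  by rewrite closed_ballE // -ball_normE /closed_ball_ /= => h1; apply: le_lt_trans h1 _; lra.
have ex w : ball (h a) (r / 4) w -> exists z, ball a r z /\ h z = w.
  move=> bw; pose T z := w - (h z - z).
  have TU : {homo T : x / closed_ball a (r / 2) x >-> closed_ball a (r / 2) x}.
    move=> z cz; have bz := cbU _ cz; move: cz bw.
    rewrite !closed_ballE // -ball_normE /closed_ball_ /= => cz bw.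
    have -> : a - T z = (h a - w) + ((h z - z) - (h a - a)).
      by apply/rowP => j; rewrite !mxE; ring.
    apply: le_trans (ler_normD _ _) _.
    have := hl _ _ bz ba; rewrite (distrC z a) => h2.
    by apply: le_trans (lerD (ltW bw) h2) _; lra.
  pose Tf : {fun closed_ball a (r / 2) >-> closed_ball a (r / 2)} :=
    HB.pack T (isFun.Build _ _ _ _ T TU).
  have ctr : is_contraction Tf.
    exists (2^-1)%:nng; split=> /=; first by lra.
    move=> [z z'] [/= /cbU bz /cbU bz'].
    have -> : T z - T z' = - ((h z - z) - (h z' - z')).
      by apply/rowP => j; rewrite !mxE; ring.
    rewrite normrN.
    exact: hl.
  have [||z cz Ez] := banach_fixed_point ctr.
  - exact: closed_ball_closed.
  - by exists a; rewrite closed_ballE // /closed_ball_ /= subrr normr0 ltW.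
  exists z; split; first exact: cbU.
  have E2 : z = w - (h z - z) := Ez.
  by have := congr1 (fun u => u + (h z - z)) E2; rewrite subrK addrC subrK.
pose k w := if pselect (exists z, ball a r z /\ h z = w) is left e
  then sval (cid e) else a.
have kP w : ball (h a) (r / 4) w -> ball a r (k w) /\ h (k w) = w.
  move=> /ex e; rewrite /k; case: pselect => // e'.
  by case: (cid e').
exists k; split=> // [w w' /kP[b1 e1] /kP[b2 e2]|z bz /kP[b1 e1]].
  by have := expand _ _ b1 b2; rewrite e1 e2.
apply/eqP; rewrite -subr_eq0 -normr_le0.
by apply: le_trans (expand _ _ b1 bz) _; rewrite e1 subrr normr0 mulr0.
Qed.

Lemma linear_bounded n m (L : {linear 'rV[R]_n -> 'rV[R]_m}) :
  exists2 c, 0 < c & forall v, `|L v| <= c * `|v|.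
Proof.
apply: linear_lipschitz => z; apply: (@Ck_linear R n m 0 setT L) => //.
exact: openT.
Qed.

(** Bootstrapping: the derivative of k at w is the inverse matrix of dh at k w, so if k is C^j then
    so is its derivative by Cramer's formula, and k is C^(j+1). The Lipschitz bound on k starts the
    argument, giving continuity and differentiability. *)
Lemma Ck_inverse n (h k : 'rV[R]_n -> 'rV[R]_n) (V W : set 'rV[R]_n) :
  open V -> open W -> (forall j, Ck j V h) ->
  (forall z, V z -> lin1_mx ('d h z) \in unitmx) ->
  (forall w, W w -> V (k w) /\ h (k w) = w) ->
  (forall w w', W w -> W w' -> `|k w - k w'| <= 2 * `|w - w'|) ->
  forall j, Ck j W k.
Proof.
move=> oV oW ch uh hk kl; pose G z := lin1_mx ('d h z); pose B z := invmx (G z).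
have dh z : V z -> differentiable h z by have [+ _] := ch 1%N; exact.
have dk w0 : W w0 -> differentiable k w0 /\ 'd k w0 = mulmxr (B (k w0)) :> (_ -> _).
  move=> W0; have [V0 hk0] := hk _ W0.
  apply: differentiable_epsP => [|e e0].
    by move=> z; apply: (@Ck_linear R n n 0 setT (mulmxr (B (k w0)))) => //; exact: openT.
  have [c c0 cB] := linear_bounded (mulmxr (B (k w0))).
  (* The factor c is lost when the inverse derivative is applied to the error, the factor 2 when the
     increment of k is bounded by that of its argument. *)
  have e'0 : 0 < e / (2 * c) by rewrite divr_gt0 // mulr_gt0.
  have /nbhs_ballP[r r0 hr] := differentiable_eps (dh _ V0) e'0.
  have r20 : 0 < r / 2 by rewrite divr_gt0.
  have : \forall z \near w0, W z by apply: open_nbhs_nbhs.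
  move/nbhs0P => Wd; near=> d.
  have Wdd : W (d + w0) by rewrite addrC; near: d.
  have dr : ball 0 (r / 2) d by near: d; exact: nbhsx_ballx.
  have [_ hkd] := hk _ Wdd; set eta := k (d + w0) - k w0.
  have le_eta : `|eta| <= 2 * `|d|.
    by have := kl _ _ Wdd W0; rewrite addrK.
  have reta : ball 0 r eta.
    move: dr; rewrite -!ball_normE /= !sub0r !normrN => dr.
    by apply: le_lt_trans le_eta _; lra.
  have := hr _ reta; rewrite /= {1}/eta subrK hkd hk0 addrK => H.
  (* The linearisation error of k at w0 is, up to sign, the image under the inverse derivative of
     the linearisation error of h at k w0, because d is the increment of h over eta. *)
  have -> : k (d + w0) - k w0 - d *m B (k w0) =
            - ((d - 'd h (k w0) eta) *m B (k w0)).
    rewrite mulmxBl opprB; congr (_ - _).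
    by rewrite -(mul_rV_lin1 ('d h (k w0))) mulmxK //; exact: uh.
  rewrite normrN; apply: le_trans (cB _) _.
  have -> : e * `|d| = c * (e / (2 * c) * (2 * `|d|)).
    by field; rewrite gt_eqF.
  rewrite ler_pM2l //; apply: le_trans H _.
  by rewrite ler_pM2l.
elim=> [|j IH].
  by move=> w Ww; apply: differentiable_continuous; have [] := dk w Ww.
split=> [w Ww|v]; first by have [] := dk w Ww.
pose adjB z := (\det (G z))^-1 *: \adj (G z).
have cadj : entrywise (Ck j V) adjB.
  have cG : entrywise (Ck j V) G.
    move=> i l; have [_ /(_ (delta_mx 0 i))/(Ck_rV _ _ oV)/(_ l)] := ch j.+1.
    by apply: Ck_ext => // z _; rewrite mxE.
  have Pc a : Ck j V (fun=> a : R) by exact: Ck_cst.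
  have PD (f g : 'rV[R]_n -> R) : Ck j V f -> Ck j V g -> Ck j V (fun x => f x + g x) by exact: CkD.
  have PM (f g : 'rV[R]_n -> R) : Ck j V f -> Ck j V g -> Ck j V (fun x => f x * g x) by exact: CkM.
  apply: entrywise_inv => //; apply: CkV => //.
    by move=> z Vz; rewrite -unitfE -unitmxE; exact: uh.
  exact: closed_det.
have cs : Ck j W (fun w => \row_l (\sum_i v 0 i * adjB (k w) i l)).
  apply/(Ck_rV _ _ oW) => l; under eq_fun do rewrite mxE.
  apply: Ck_sum => // i; apply: CkM => //; first exact: Ck_cst.
  apply: (@Ck_comp_scalar R n n j W V k (fun z => adjB z i l)) => //.
  by move=> w /hk[].
apply: Ck_ext oW _ cs => w; rewrite inE => Ww.
have [_ E] := dk w Ww; apply: etrans (esym (congr1 (@^~ v) E)).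
apply/rowP => l; rewrite !mxE /B; apply: eq_bigr => i _.
have Vk : V (k w) by have [] := hk w Ww.
by rewrite /invmx /G (uh _ Vk).
Unshelve. all: by end_near. Qed.

Lemma smooth_local_inverse n (h : 'rV[R]_n -> 'rV[R]_n) a :
  smooth_near a h -> (forall v, 'd h a v = v) ->
  exists k, [/\ smooth_near (h a) k, k (h a) = a & \forall z \near a, k (h z) = z].
Proof.
(* Each of the n basis directions may contribute e |v|, and n e <= 1/2. The successor n.+1 keeps the
   denominator positive when n = 0. *)
move=> [V [oV Va ch]] dha; pose e : R := 1 / (2 * n.+1%:R).
have e0 : 0 < e by rewrite divr_gt0 // mulr_gt0.
have dh z : V z -> differentiable h z by have [+ _] := ch 1%N; exact.
have tr (u v w : 'rV[R]_n) : v = w -> `|v - u| < e -> `|u - w| < e.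
  by move=> ->; rewrite distrC.
have near_d : \forall z \near a, forall i : 'I_n,
    `|'d h z (delta_mx 0 i) - delta_mx 0 i| < e.
  apply: (@filter_forall _ _ _ (nbhs a)) => i.
  have [_ /(_ (delta_mx 0 i))] := ch 1%N => /(_ a Va) ci.
  move/cvgrPdist_lt: ci => /(_ e e0); apply: filterS => z /=.
  exact: tr (dha _).
have : \forall z \near a, V z /\ forall i : 'I_n,
    `|'d h z (delta_mx 0 i) - delta_mx 0 i| < e.
  by near=> z; split; near: z => //; exact: open_nbhs_nbhs.
move=> /nbhs_ballP[r r0 hr].
have bV z : ball a r z -> V z by move=> /hr[].
have bd z v : ball a r z -> `|'d h z v - v| <= 2^-1 * `|v|.
  move=> /hr[Vz hz]; rewrite {1 2}[v]row_sum_delta linear_sum -sumrB.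
  apply: le_trans (ler_norm_sum _ _ _) _.
  apply: (@le_trans _ _ (\sum_(i < n) e * `|v|)).
    apply: ler_sum => i _; rewrite linearZ -scalerBr normrZ mulrC.
    by apply: ler_pM => //; [exact/ltW|exact: mx_norm_coord].
  rewrite sumr_const card_ord -mulrnAl ler_wpM2r //.
  rewrite /e -mulr_natl mul1r ler_pdivrMr ?mulr_gt0 // mulKf //.
  by rewrite ler_nat.
have dg z : ball a r z -> differentiable (fun z => h z - z) z /\
    'd (fun z => h z - z) z = 'd h z \- id :> (_ -> _).
  move=> bz; have := is_diffB (differentiableP (dh _ (bV _ bz))) (is_diff_id z).
  by move=> [? E].
have [||k [k1 k2 k3]] := @lipschitz_local_inverse n h a r.
- by [].
- move=> z z' bz bz'.
  apply: (@lipschitz_on_ball n n (fun z => h z - z) a r 2^-1) => // [|y v by_].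
    by move=> y /dg[].
  have [_ E] := dg _ by_; rewrite (congr1 (@^~ v) E).
  exact: bd.
have r4 : 0 < r / 4 by rewrite divr_gt0.
exists k; split.
- exists (ball (h a) (r / 4)); split; [exact: ball_open|exact: ballxx|].
  apply: (@Ck_inverse n h k (ball a r)) => //; [exact: ball_open|exact: ball_open| |].
    by move=> j; apply: Ck_sub (ch j).
  (* If dh z kills v then |v| = |dh z v - v| <= |v|/2, so v = 0. *)
  move=> z bz; rewrite -row_free_unit; apply: inj_row_free => v.
  rewrite mul_rV_lin1 => v0; have := bd z v bz.
  by rewrite v0 sub0r normrN => h1; apply/eqP; rewrite -normr_le0; lra.
- by apply: k3; exact: ballxx.
have ca : {for a, continuous h} by apply: differentiable_continuous; exact: dh.
near=> z; apply: k3; near: z; first exact: nbhsx_ballx.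
by apply: ca; exact: nbhsx_ballx.
Unshelve. all: by end_near. Qed.

End InverseFunction.

(** * Extension of functions from submanifolds and bump functions *)

Section Extension.
Context {R : realType}.

(** Injectivity of the differential gives a linear left inverse B in charts. Then H followed by B
    has identity derivative at [a] and a local inverse k, so y |-> cinv c (k (d y *m B)) is a smooth
    local retraction onto N, and f is composed with it. *)
Lemma smooth_extension (M N : manifold R) (i : N -> M) (x : N) (f : N -> R) :
  smooth_map i -> injective (@tmap R N M i x) -> smooth_fun_at x f ->
  exists2 g : M -> R, smooth_fun_at (i x) g & \forall y \near x, g (i y) = f y.
Proof.
move=> si inj sf.
pose c := chart_at x; pose d := chart_at (i x); pose a := c x.
have cx : cdom c x := chart_at_dom x; have dx : cdom d (i x) := chart_at_dom (i x).
pose H := d \o i \o cinv c; have sH : smooth_near a H by have [_] := si; exact.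
have dH : differentiable H a by exact: smooth_near_differentiable.
have [B GB] : exists B, lin1_mx ('d H a) *m B = 1%:M.
  apply/row_freeP; apply: inj_row_free => v; rewrite mul_rV_lin1 => v0.
  by apply: (inj v 0); rewrite /tmap [LHS]v0 linear0.
pose h := mulmxr B \o H.
have sh : smooth_near a h by apply: smooth_near_comp sH (smooth_near_linear _ _).
have cB : continuous (mulmxr B : 'rV[R]_(mdim M) -> 'rV[R]_(mdim N)).
  by move=> z; apply: smooth_near_continuous; exact: smooth_near_linear.
have dh v : 'd h a v = v.
  rewrite /h diff_comp //; last exact: linear_differentiable.
  by rewrite diff_lin //= -mul_rV_lin1 -mulmxA GB mulmx1.
have [k [sk ka kh]] := smooth_local_inverse sh dh.
have ha : h a = d (i x) *m B by rewrite /h /= /H /= ctoK.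
exists (fun y => f (cinv c (k (d y *m B)))).
  have s1 : smooth_near (d (i x)) (f \o cinv c \o (k \o mulmxr B)).
    apply: smooth_near_comp_scalar; last by rewrite /= -ha ka.
    by apply: smooth_near_comp; [exact: smooth_near_linear|rewrite /= -ha].
  apply: smooth_near_ext s1; have := cimg_nbhs dx; apply: filterS => z [_ E] /=.
  by rewrite E.
have := cto_continuous cx kh; have := cdom_nbhs cx => n1 n2.
near=> y; have cy : cdom c y by near: y.
have E : k (h (c y)) = c y by near: y.
by move: E; rewrite /h /= /H /= (ctoK cy) => ->; rewrite ctoK.
Unshelve. all: by end_near. Qed.

End Extension.

(** * Smooth functions that are flat at the origin *)

Section FlatExponential.
Context {R : realType}.
Implicit Types t : R.

(* The functions t^-m exp(-1/t), extended by 0 to t <= 0, are closed under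
   differentiation up to linear combinations. *)
Definition flat_exp (m : nat) t : R :=
  if 0 < t then t^-1 ^+ m * expR (- t^-1) else 0.

Lemma flat_exp_ge0 m t : 0 <= flat_exp m t.
Proof.
rewrite /flat_exp; case: ifP => // t0.
by rewrite mulr_ge0 ?expR_ge0 // exprn_ge0 // invr_ge0 ltW.
Qed.

(** The term of degree m+2 in the series of exp(1/t) dominates. The exponent 2 is chosen so that the
    bound is o(t), which gives differentiability with derivative 0 at the origin. *)
Lemma flat_exp_le m t : `|flat_exp m t| <= (m.+2)`!%:R * `|t| ^+ 2.
Proof.
rewrite ger0_norm ?flat_exp_ge0 // /flat_exp; case: ifP => [t0|_]; last first.
  by rewrite mulr_ge0 // exprn_ge0.
rewrite (ger0_norm (ltW t0)) expRN ler_pdivrMr ?expR_gt0 //.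
have ti : 0 <= t^-1 by rewrite invr_ge0 ltW.
have := expR_ge1Dxn m.+1 ti => H.
have {H} : t^-1 ^+ m.+2 / (m.+2)`!%:R <= expR t^-1.
  by apply: le_trans H; rewrite lerDr.
have f0 : 0 < (m.+2)`!%:R :> R by rewrite ltr0n fact_gt0.
rewrite ler_pdivrMr // => H.
have -> : t^-1 ^+ m = t^-1 ^+ m.+2 * t ^+ 2.
  by rewrite -addn2 exprD -mulrA -exprMn mulVf ?gt_eqF // expr1n mulr1.
apply: le_trans (ler_wpM2r (exprn_ge0 2 (ltW t0)) H) _.
by rewrite -mulrA mulrC.
Qed.

Definition flat_exp' m t : R := flat_exp m.+2 t - m%:R * flat_exp m.+1 t.

Lemma flat_exp_diff m t : differentiable (flat_exp m) t /\
  forall v, 'd (flat_exp m) t v = v * flat_exp' m t.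
Proof.
suff H : is_derive t 1 (flat_exp m) (flat_exp' m t).
  have dt : differentiable (flat_exp m) t by apply/derivable1_diffP; case: H.
  split=> // v; rewrite diff1E // /= derive1E.
  by case: H => _ ->.
have [t0|t0|t0] := ltgtP 0 t.
- have near_t : \forall s \near t, s^-1 ^+ m * expR (- s^-1) = flat_exp m s.
    near=> s; rewrite /flat_exp; case: ifPn => //.
    by rewrite -leNgt leNgt => /negP[]; near: s; exact: lt_nbhsr.
  apply: (near_eq_is_derive near_t).
  have tn0 : t != 0 by rewrite gt_eqF.
  have dV : is_derive t 1 (fun s : R => s^-1) (- t ^- 2).
    apply: DeriveDef; first exact: (@derivableV _ _ id).
    by rewrite (@deriveV _ _ id) // derive_id /GRing.scale /= mulr1.
  have dN : is_derive t 1 (fun s : R => - s^-1) (t ^- 2).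
    by apply: is_derive_eq; rewrite opprK.
  have dE : is_derive t 1 (expR \o (fun s : R => - s^-1)) (expR (- t^-1) * t ^- 2).
    have dEx := is_derive_expR (- t^-1).
    exact: (@is_derive1_comp R expR (fun s : R => - s^-1) t (expR (- t^-1)) (t ^- 2) dEx dN).
  have dX : is_derive t 1 (fun s : R => s^-1 ^+ m) (- m%:R * t^-1 ^+ m.+1).
    case: m {near_t} => [|m].
      by under eq_fun do rewrite expr0; rewrite oppr0 mul0r; exact: is_derive_cst.
    rewrite (_ : (fun s => _) = (fun s : R => s^-1) ^+ m.+1); last first.
      by rewrite exprfctE.
    apply: (is_derive_eq (is_deriveX m.+1 dV)).
    rewrite /GRing.scale /= -exprVn !exprS; ring.
  apply: (is_derive_eq (is_deriveM dX dE)).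
  rewrite /flat_exp' /flat_exp t0 /= -exprVn !exprS /GRing.scale /=; ring.
- have near_t : \forall s \near t, (fun=> 0) s = flat_exp m s.
    near=> s; rewrite /flat_exp; case: ifPn => //.
    by rewrite ltNge => /negP[]; apply: ltW; near: s; exact: lt_nbhsl.
  have -> : flat_exp' m t = 0.
    by rewrite /flat_exp' /flat_exp ltNge (ltW t0) /= mulr0 subr0.
  by apply: (near_eq_is_derive near_t).
- rewrite -t0.
  have -> : flat_exp' m 0 = 0 by rewrite /flat_exp' /flat_exp ltxx mulr0 subr0.
  have [||d0 E] := @differentiable_epsP R R R (flat_exp m) 0 (\0 : {linear R -> R}).
  + by move=> z; exact: cst_continuous.
  + move=> e e0; have f0 : 0 < (m.+2)`!%:R :> R by rewrite ltr0n fact_gt0.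
    near=> s; rewrite addr0 {2}/flat_exp ltxx !subr0.
    apply: le_trans (flat_exp_le m s) _; rewrite expr2 mulrA ler_wpM2r //.
    rewrite mulrC -ler_pdivlMr //; apply: ltW; near: s.
    have ef : 0 < e / (m.+2)`!%:R by rewrite divr_gt0.
    have := nbhsx_ballx (0 : R) _ ef; apply: filterS => s.
    by rewrite -ball_normE /= sub0r normrN.
  apply: DeriveDef; first exact/derivable1_diffP.
  by rewrite deriveE // E.
Unshelve. all: by end_near. Qed.

Lemma Ck_flat_exp n k (U : set 'rV[R]_n) (f : 'rV[R]_n -> R) m :
  open U -> (forall k, Ck k U f) -> Ck k U (fun z => flat_exp m (f z)).
Proof.
(* The induction generalises m because one derivative passes from m to m+1 and m+2. *)
move=> oU cf; elim: k m => [|k IH] m.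
  move=> z Uz; apply: (@cvg_comp _ _ _ f (flat_exp m) _ _ _ (cf 0%N z Uz)).
  by apply: differentiable_continuous; have [] := flat_exp_diff m (f z).
have [df cdf] := cf k.+1; split=> [z Uz|v].
  by apply: (differentiable_comp (df z Uz)); have [] := flat_exp_diff m (f z).
have cs : Ck k U (fun z => 'd f z v *
    (flat_exp m.+2 (f z) + - m%:R * flat_exp m.+1 (f z))).
  apply: CkM => //; first exact: cdf.
  apply: CkD => //.
  by apply: CkM => //; exact: Ck_cst.
apply: Ck_ext oU _ cs => z; rewrite inE => Uz.
have [d1 d2] := flat_exp_diff m (f z).
rewrite (diff_comp (df z Uz) d1) /= d2 /flat_exp'; congr (_ * _).
by rewrite mulNr.
Qed.

Lemma smooth_near_flat_exp n (a : 'rV[R]_n) (f : 'rV[R]_n -> R) m :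
  smooth_near a f -> smooth_near a (fun z => flat_exp m (f z)).
Proof.
by move=> [U [oU Ua cf]]; exists U; split=> // k; exact: Ck_flat_exp.
Qed.

Lemma flat_exp0_gt0 t : 0 < t -> 0 < flat_exp 0 t.
Proof. by move=> t0; rewrite /flat_exp t0 expr0 mul1r expR_gt0. Qed.

Lemma flat_exp_le0 m t : t <= 0 -> flat_exp m t = 0.
Proof. by move=> t0; rewrite /flat_exp ltNge t0. Qed.

End FlatExponential.

(** * Cut-off and bump functions *)

Section Bump.
Context {R : realType}.

(** The quotient u/(u+w), where u is positive for q < r^2 and w for q > r^2/2, so that the
    denominator never vanishes. The Euclidean square q replaces the maximum norm, which is not
    smooth; q z < r^2 still puts z in the closed ball of radius r. *)
Lemma smooth_cutoff n (a : 'rV[R]_n) r : 0 < r ->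
  exists psi : 'rV[R]_n -> R, [/\ (forall z, smooth_near z psi),
    (forall z, ~ closed_ball a r z -> psi z = 0) &
    \forall z \near a, psi z = 1].
Proof.
move=> r0; pose q (z : 'rV[R]_n) := \sum_j (z 0 j - a 0 j) ^+ 2.
have sq z : smooth_near z q.
  exists setT; split=> // [|k]; first exact: openT.
  have cc j : Ck k setT (fun z : 'rV[R]_n => z 0 j - a 0 j).
    apply: CkD; first exact: openT; last exact: Ck_cst.
    by apply: (Ck_rV _ _ openT).1; exact: (@Ck_linear _ _ _ _ setT idfun openT).
  by apply: Ck_sum; [exact: openT|move=> j; apply: CkM => //; exact: openT].
have q0 z : 0 <= q z by apply: sumr_ge0 => j _; exact: sqr_ge0.
have r2 : 0 < r ^+ 2 by rewrite exprn_gt0.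
pose u z := flat_exp 0 (r ^+ 2 - q z); pose w z := flat_exp 0 (q z - r ^+ 2 / 2).
have su z : smooth_near z u.
  apply: smooth_near_flat_exp; apply: smooth_nearD; first exact: smooth_near_cst.
  have := smooth_nearM (smooth_near_cst z (-1 : R)) (sq z).
  by under eq_fun do rewrite mulN1r.
have sw z : smooth_near z w.
  by apply: smooth_near_flat_exp; apply: smooth_nearD => //; exact: smooth_near_cst.
have uw z : u z + w z != 0.
  have u0 : 0 <= u z by exact: flat_exp_ge0.
  have w0 : 0 <= w z by exact: flat_exp_ge0.
  apply: lt0r_neq0; have [lt|ge] := ltP (q z) (r ^+ 2).
    by apply: ltr_pwDl => //; apply: flat_exp0_gt0; rewrite subr_gt0.
  by apply: ltr_wpDl => //; apply: flat_exp0_gt0; lra.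
exists (fun z => u z / (u z + w z)); split.
- move=> z; apply: smooth_nearM => //; apply: smooth_nearV => //.
  exact: smooth_nearD.
- move=> z nz; suff -> : u z = 0 by rewrite mul0r.
  apply: flat_exp_le0; rewrite subr_le0 leNgt; apply/negP => ltq; apply: nz.
  rewrite closed_ballE // /closed_ball_ /=; apply: mx_norm_le; first exact: ltW.
  move=> j; rewrite !mxE distrC -ler_sqr ?nnegrE //; last exact: ltW.
  rewrite real_normK ?num_real //.
  apply: le_trans (ltW ltq); rewrite /q (bigD1 j) //= lerDl.
  by apply: sumr_ge0 => l _; exact: sqr_ge0.
have qa : q a = 0 by rewrite /q big1 // => j _; rewrite subrr expr0n.
have : \forall z \near a, q z < r ^+ 2 / 2.
  have cq : {for a, continuous q} by exact: smooth_near_continuous.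
  apply: (cq [set s | s < r ^+ 2 / 2]); rewrite qa; apply: lt_nbhsl.
  by rewrite divr_gt0.
apply: filterS => z qz; have w0 : w z = 0 by apply: flat_exp_le0; lra.
by move: (uw z); rewrite w0 addr0 => u0; rewrite divff.
Qed.

Lemma smooth_bump (M : manifold R) (x : M) (U : set M) : open U -> U x ->
  exists chi : M -> R, [/\ (forall y, smooth_fun_at y chi),
    (forall y, U y \/ \forall z \near y, chi z = 0) &
    \forall y \near x, chi y = 1].
Proof.
move=> oU Ux; pose c := chart_at x; have cx : cdom c x := chart_at_dom x.
have : \forall z \near c x, (c @` cdom c) z /\ U (cinv c z).
  have n1 : \forall z \near c x, (c @` cdom c) z.
    by apply: open_nbhs_nbhs; split; [exact: cimg_open|exists x].
  have n2 : \forall y \near x, U y by exact: open_nbhs_nbhs.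
  by near=> z; split; near: z => //; exact: near_cinv.
move=> /nbhs_ballP[r0 r0p hr]; pose r := r0 / 2.
have rp : 0 < r by rewrite divr_gt0.
have hK z : closed_ball (c x) r z -> (c @` cdom c) z /\ U (cinv c z).
  rewrite closed_ballE // /closed_ball_ /= => hz; apply: hr.
  rewrite -ball_normE /=; apply: le_lt_trans hz _.
  by rewrite ltr_pdivrMr // ltr_pMr // ltr1n.
have [psi [spsi psi0 psi1]] := smooth_cutoff (c x) rp.
(* K is compact, hence closed in the Hausdorff space M; therefore extension by zero from the chart
   domain is smooth, the function vanishing on the open complement of K. *)
pose K := cinv c @` closed_ball (c x) r.
have cK : closed K.
  apply: compact_closed; first exact: m_hausdorff.
  apply: continuous_compact.
    apply: continuous_in_subspaceT => z; rewrite inE => /hK[hz _].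
    exact: cinv_continuous.
  apply: bounded_closed_compact; last exact: closed_ball_closed.
  exists (`|c x| + r); split; first exact: num_real.
  move=> b ltb z; rewrite closed_ballE // /closed_ball_ /= => hz.
  rewrite -(subKr (c x) z) (le_trans (ler_normB _ _)) // ltW //.
  by apply: le_lt_trans ltb; rewrite lerD2l.
pose chi y := if pselect (cdom c y) then psi (c y) else 0.
have chi_in y : cdom c y -> chi y = psi (c y) by rewrite /chi; case: pselect.
have chi_out y : ~ K y -> \forall z \near y, chi z = 0.
  move=> Ky; have oK : open (~` K) by exact: closed_openC.
  have : \forall z \near y, (~` K) z by apply: open_nbhs_nbhs.
  apply: filterS => z Kz; rewrite /chi; case: pselect => // cz.
  by apply: psi0 => hz; apply: Kz; exists (c z) => //; rewrite ctoK.
have K_in y : K y -> cdom c y /\ U y.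
  by move=> [z /hK[[w cw <-] Uw] <-]; move: Uw; rewrite ctoK.
exists chi; split.
- move=> y; have [cy|ncy] := pselect (cdom c y).
    apply/(smooth_fun_at_chart _ cy); apply: smooth_near_ext (spsi (c y)).
    by have := cimg_nbhs cy; apply: filterS => z [cz E] /=; rewrite chi_in // E.
  have nK : ~ K y by move=> /K_in[].
  apply: smooth_fun_at_ext (smooth_fun_at_cst y 0).
  by have := chi_out _ nK; apply: filterS => z.
- move=> y; have [/K_in[]|/chi_out] := pselect (K y); first by left.
  by right.
have n1 := cto_continuous cx psi1; have n2 := cdom_nbhs cx.
near=> y; rewrite chi_in; first by near: y.
by near: y.
Unshelve. all: by end_near. Qed.

End Bump.

(** * Linear algebra of lagrangian subspaces and of orthogonal projectors *)

Section SymmetricForms.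
Variables (F : fieldType) (vT : vectType F) (f : {symmetric vT}).
Implicit Types (u v : vT) (U V W : {vspace vT}).

Lemma symmetricC u v : f u v = f v u.
Proof. by rewrite hermC /= expr0 mul1r. Qed.

(** The functionals f(-, b_i), for a basis b of U, number dim U and their common kernel lies in the
    orthogonal; rank-nullity concludes. *)
Lemma dim_orthov_ge U : (\dim {:vT} <= \dim (orthov f U) + \dim U)%N.
Proof.
pose b := vbasis U.
pose g v := \row_(i < \dim U) f v b`_i.
have blin : linear g.
  by move=> a u v; apply/rowP => i; rewrite !mxE linearPl.
pose gM := GRing.isLinear.Build _ _ _ _ g blin.
pose bL : {linear vT -> 'rV[F]_(\dim U)} := HB.pack g gM.
rewrite -(limg_ker_dim (linfun bL) fullv) capfv leq_add //.
  apply/dimvS/subvP => v; rewrite memv_ker lfunE /= => /eqP bv0.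
  apply/mem_orthovP => w /coord_vbasis ->; rewrite linear_sumr big1 // => i _.
  rewrite linearZr_LR /=; have := congr1 (fun r : 'rV[F]_(\dim U) => r 0 i) bv0.
  by rewrite !mxE => ->; rewrite mulr0.
by apply: leq_trans (dimvS (subvf _)) _; rewrite dimvf /dim /= mul1n.
Qed.

Hypothesis nd : nondegenerate f.

Lemma nondegenerate_eq0 u : (forall v, f u v = 0) -> u = 0.
Proof.
move=> H; apply/eqP; rewrite -memv0 -(eqP nd); apply/mem_orthovP => v _.
exact: H.
Qed.

(** For the missing inequality take a complement C of the orthogonal of U. A vector of U orthogonal
    to C is orthogonal to everything, so U meets the orthogonal of C trivially, and counting
    dimensions gives dim U <= dim C. *)
Lemma dim_orthov U : (\dim (orthov f U) + \dim U)%N = \dim {:vT}.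
Proof.
apply/eqP; rewrite eqn_leq dim_orthov_ge andbT.
set C := (orthov f U)^C%VS.
have dimC : (\dim (orthov f U) + \dim C)%N = \dim {:vT}.
  by rewrite -dimv_disjoint_sum ?capv_compl // addv_complf.
have UC0 : (U :&: orthov f C = 0)%VS.
  apply/eqP; rewrite -subv0; apply/subvP => u; rewrite memv_cap memv0.
  move=> /andP[uU uC]; apply/eqP/nondegenerate_eq0 => v.
  have : v \in (orthov f U + C)%VS by rewrite addv_complf memvf.
  case/memv_addP => w wU [c cC ->]; rewrite linearDr /=.
  by rewrite symmetricC (mem_orthovP wU) // (mem_orthovP uC) // addr0.
rewrite -dimC leq_add2l.
have := dimvS (subvf (U + orthov f C)%VS).
rewrite dimv_disjoint_sum // => H.
have := leq_trans H (dim_orthov_ge C).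
by rewrite addnC leq_add2l.
Qed.

Lemma orthovK U : orthov f (orthov f U) = U.
Proof.
apply/esym/eqP; rewrite eqEdim -(leq_add2l (\dim (orthov f U))).
rewrite [X in (X <= _)%N]addnC !dim_orthov leqnn andbT.
apply/subvP => u uU; apply/mem_orthovP => v vU; rewrite symmetricC.
exact: (mem_orthovP vU).
Qed.

Lemma dim_lagrangian U : U = orthov f U -> (\dim U).*2 = \dim {:vT}.
Proof. by move=> UE; rewrite -addnn {1}UE dim_orthov. Qed.

Lemma orthov_add U V : orthov f (U + V) = (orthov f U :&: orthov f V)%VS.
Proof.
apply/vspaceP => u; rewrite memv_cap; apply/idP/andP.
  move=> /mem_orthovP H; split; apply/mem_orthovP => v vU; apply: H.
    exact: (subvP (addvSl _ _)).
  exact: (subvP (addvSr _ _)).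
move=> [/mem_orthovP HU /mem_orthovP HV]; apply/mem_orthovP => w /memv_addP.
by move=> [a aU [b bV ->]]; rewrite linearDr /= HU // HV // addr0.
Qed.

(** This is the maximality half of the claim that L_quot is lagrangian. As u is orthogonal to K^perp
    /\ L = (K + L)^perp, it lies in K + L; writing u = k + l, the part l = u - k stays in K^perp
    because K is isotropic. *)
Lemma coisotropic_reduction K L u : (K <= orthov f K)%VS -> L = orthov f L ->
  u \in orthov f K -> (forall l, l \in orthov f K -> l \in L -> f u l = 0) ->
  exists2 l, l \in (orthov f K :&: L)%VS & u - l \in K.
Proof.
move=> KK LL uK uL.
have : u \in (K + L)%VS.
  rewrite -(orthovK (K + L)); apply/mem_orthovP => l.
  by rewrite orthov_add -LL memv_cap => /andP[lK lL]; exact: uL.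
move=> /memv_addP[k kK [l lL E]]; exists l; last by rewrite E addrK.
rewrite memv_cap lL andbT (_ : l = u - k); last by rewrite E addrC addKr.
by rewrite memvB //; exact: (subvP KK).
Qed.

End SymmetricForms.

(** * Euclidean orthogonal projectors onto row spaces *)

Section OrthogonalProjector.
Variable R : realType.

Lemma row_form_eq0 m (u : 'rV[R]_m) : u *m u^T = 0 -> u = 0.
Proof.
move=> /(congr1 (fun A : 'M[R]_1 => A 0 0)); rewrite !mxE => /eqP.
rewrite psumr_eq0 => [/allP H|i _]; last by rewrite mxE -expr2 sqr_ge0.
apply/rowP => i; have := H i (mem_index_enum i); rewrite !mxE /= -expr2.
by rewrite sqrf_eq0 => /eqP.
Qed.

Lemma gram_unit r m (B : 'M[R]_(r, m)) : (B *m B^T \in unitmx) = row_free B.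
Proof.
apply/idP/idP => [U|fB].
  by apply/row_freeP; exists (B^T *m invmx (B *m B^T)); rewrite mulmxA mulmxV.
rewrite -row_free_unit; apply: inj_row_free => v vB.
apply: (row_free_inj fB); rewrite mul0mx; apply: row_form_eq0.
by rewrite trmx_mul mulmxA -(mulmxA v) vB mul0mx.
Qed.

(** For row-free B, the orthogonal projection onto the row space of B, acting on row vectors by
    right multiplication. *)
Definition projmx r m (B : 'M[R]_(r, m)) : 'M[R]_m :=
  B^T *m invmx (B *m B^T) *m B.

Lemma projmx_sub r m (B : 'M[R]_(r, m)) : (projmx B <= B)%MS.
Proof. exact: submxMl. Qed.

Lemma projmx_tr r m (B : 'M[R]_(r, m)) : (projmx B)^T = projmx B.
Proof.
by rewrite /projmx !trmx_mul trmx_inv trmx_mul !trmxK mulmxA.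
Qed.

Lemma projmx_id r m k (B : 'M[R]_(r, m)) (u : 'M[R]_(k, m)) : row_free B ->
  (u <= B)%MS -> u *m projmx B = u.
Proof.
rewrite -gram_unit => fB /submxP[D ->].
by rewrite /projmx !mulmxA -(mulmxA D) mulmxK.
Qed.

(** Projectors with the same row space absorb each other, and transposing a product of symmetric
    matrices reverses it. *)
Lemma projmx_eqmx r s m (B : 'M[R]_(r, m)) (C : 'M[R]_(s, m)) :
  row_free B -> row_free C -> (B :=: C)%MS -> projmx B = projmx C.
Proof.
move=> fB fC BC.
have e1 : projmx B *m projmx C = projmx B.
  by apply: projmx_id => //; rewrite -BC projmx_sub.
have e2 : projmx C *m projmx B = projmx C.
  by apply: projmx_id => //; rewrite BC projmx_sub.
transitivity ((projmx C *m projmx B)^T); last by rewrite e2 projmx_tr.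
by rewrite trmx_mul !projmx_tr e1.
Qed.

Definition orthoproj k m (A : 'M[R]_(k, m)) := projmx (row_base A).

Lemma orthoprojE k r m (A : 'M[R]_(k, m)) (B : 'M[R]_(r, m)) :
  row_free B -> (B :=: A)%MS -> orthoproj A = projmx B.
Proof.
move=> fB BA; apply: projmx_eqmx => //; first exact: row_base_free.
exact: eqmx_trans (eq_row_base A) (eqmx_sym BA).
Qed.

(** This lets a projector defined pointwise from arbitrary bases be computed near a point from any
    smooth spanning matrix. *)
Lemma orthoproj_eqmx k r m (A : 'M[R]_(k, m)) (B : 'M[R]_(r, m)) :
  (A :=: B)%MS -> orthoproj A = orthoproj B.
Proof.
move=> AB; apply: orthoprojE; first exact: row_base_free.
exact: eqmx_trans (eq_row_base B) (eqmx_sym AB).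
Qed.

Lemma orthoproj_tr k m (A : 'M[R]_(k, m)) : (orthoproj A)^T = orthoproj A.
Proof. exact: projmx_tr. Qed.

Lemma orthoproj_id k m s (A : 'M[R]_(k, m)) (u : 'M[R]_(s, m)) :
  (u <= A)%MS -> u *m orthoproj A = u.
Proof.
by move=> uA; apply: projmx_id; [exact: row_base_free|rewrite eq_row_base].
Qed.

Lemma orthoproj_eq k m (A : 'M[R]_(k, m)) : (orthoproj A :=: A)%MS.
Proof.
apply/eqmxP/andP; split.
  by rewrite -(eq_row_base A); exact: projmx_sub.
by rewrite -{1}(orthoproj_id (submx_refl A)) submxMl.
Qed.

Lemma orthoproj_ker k m s (A : 'M[R]_(k, m)) (u : 'M[R]_(s, m)) :
  (u *m A^T == 0) = (u *m orthoproj A == 0).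
Proof.
apply/eqP/eqP => [uA|uP].
  have /submxP[D E] : (orthoproj A <= A)%MS by rewrite orthoproj_eq.
  by rewrite -orthoproj_tr E trmx_mul mulmxA uA mul0mx.
rewrite -(orthoproj_id (submx_refl A)) trmx_mul orthoproj_tr mulmxA uP.
by rewrite mul0mx.
Qed.

(* The orthogonal projection of a smoothly varying subspace has vanishing
   derivative as soon as its derivative maps into the subspace. *)
Lemma projector_derivative m (P D : 'M[R]_m) : P *m P = P -> P^T = P ->
  D^T = D -> D = D *m P + P *m D -> D *m (1%:M - P) = 0 -> D = 0.
Proof.
move=> PP Pt Dt DE; rewrite mulmxBr mulmx1 => /eqP; rewrite subr_eq0 => /eqP D1.
have D2 : D = P *m D by rewrite -{1}Dt {1}D1 trmx_mul Pt Dt.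
by move: DE; rewrite -D1 -D2 => /eqP; rewrite addrC -subr_eq subrr eq_sym => /eqP.
Qed.

End OrthogonalProjector.

(** * Smooth matrix functions of locally constant rank *)

Section SmoothMatrices.
Context {R : realType} (M : manifold R).
Implicit Type x : M.

Definition smooth_mx x m n (A : M -> 'M[R]_(m, n)) := entrywise (smooth_fun_at x) A.

Lemma smooth_mx_cst x m n (A : 'M[R]_(m, n)) : smooth_mx x (fun=> A).
Proof. by move=> i j; exact: smooth_fun_at_cst. Qed.

Lemma smooth_mx_ext x m n (A B : M -> 'M[R]_(m, n)) :
  {near x, A =1 B} -> smooth_mx x A -> smooth_mx x B.
Proof.
move=> AB sA i j; apply: smooth_fun_at_ext (sA i j).
by apply: filterS AB => y ->.
Qed.

Lemma smooth_mx_mul x m n p (A : M -> 'M[R]_(m, n)) (B : M -> 'M[R]_(n, p)) :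
  smooth_mx x A -> smooth_mx x B -> smooth_mx x (fun y => A y *m B y).
Proof.
apply: entrywise_mul; [exact: smooth_fun_at_cst|exact: smooth_fun_atD|].
exact: smooth_fun_atM.
Qed.

Lemma smooth_mx_tr x m n (A : M -> 'M[R]_(m, n)) :
  smooth_mx x A -> smooth_mx x (fun y => (A y)^T).
Proof. exact: entrywise_tr. Qed.

Lemma smooth_mxB x m n (A B : M -> 'M[R]_(m, n)) :
  smooth_mx x A -> smooth_mx x B -> smooth_mx x (fun y => A y - B y).
Proof.
move=> sA sB i j; under eq_fun do rewrite !mxE -mulN1r.
by apply: smooth_fun_atD => //; apply: smooth_fun_atM => //; exact: smooth_fun_at_cst.
Qed.

Lemma smooth_det x n (A : M -> 'M[R]_n) :
  smooth_mx x A -> smooth_fun_at x (fun y => \det (A y)).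
Proof.
apply: closed_det; [exact: smooth_fun_at_cst|exact: smooth_fun_atD|].
exact: smooth_fun_atM.
Qed.

Lemma near_unit x n (A : M -> 'M[R]_n) : smooth_mx x A -> A x \in unitmx ->
  \forall y \near x, A y \in unitmx.
Proof.
move=> /smooth_det sd Ax.
have cd : {for x, continuous (fun y => \det (A y) : R^o)}.
  exact: smooth_fun_at_continuous.
have n0 : nbhs (\det (A x) : R^o) [set t | t != 0].
  apply: open_nbhs_nbhs; split; first exact: open_neq.
  by rewrite /= -unitfE -unitmxE.
have n1 : \forall y \near x, \det (A y) != 0 := cd _ n0.
by apply: filterS n1 => y /=; rewrite unitmxE unitfE.
Qed.

Lemma smooth_mx_inv x n (A : M -> 'M[R]_n) : smooth_mx x A -> A x \in unitmx ->
  smooth_mx x (fun y => invmx (A y)).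
Proof.
move=> sA Ax.
have sI : smooth_mx x (fun y => (\det (A y))^-1 *: \adj (A y)).
  apply: entrywise_inv => //; [exact: smooth_fun_at_cst|exact: smooth_fun_atD| |].
    exact: smooth_fun_atM.
  apply: smooth_fun_atV; last exact: smooth_det.
  by rewrite -unitfE -unitmxE.
apply: smooth_mx_ext sI; have := near_unit sA Ax; apply: filterS => y Ay.
by rewrite /invmx Ay.
Qed.

Lemma near_row_free x k m (A : M -> 'M[R]_(k, m)) : smooth_mx x A ->
  row_free (A x) -> \forall y \near x, row_free (A y).
Proof.
move=> sA fA; have := near_unit (smooth_mx_mul sA (smooth_mx_tr sA)).
by rewrite gram_unit => /(_ fA); apply: filterS => y; rewrite gram_unit.
Qed.

Lemma smooth_projmx x k m (A : M -> 'M[R]_(k, m)) : smooth_mx x A ->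
  row_free (A x) -> smooth_mx x (fun y => projmx (A y)).
Proof.
move=> sA fA; apply: smooth_mx_mul => //; apply: smooth_mx_mul.
  exact: smooth_mx_tr.
apply: smooth_mx_inv; last by rewrite gram_unit.
by apply: smooth_mx_mul => //; exact: smooth_mx_tr.
Qed.

(* Independence of the rows chosen at [x] is an open condition. *)
Lemma constant_rank_rows x k m (A : M -> 'M[R]_(k, m)) : smooth_mx x A ->
  (\forall y \near x, (\rank (A y) <= \rank (A x))%N) ->
  exists g : 'I_(\rank (A x)) -> 'I_k, \forall y \near x,
    row_free (rowsub g (A y)) /\ (rowsub g (A y) :=: A y)%MS.
Proof.
move=> sA rA; exists (maxrankfun (A x)).
have sB : smooth_mx x (fun y => rowsub (maxrankfun (A x)) (A y)).
  by move=> i j; under eq_fun do rewrite mxE; exact: sA.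
have := near_row_free sB (maxrowsub_free _) => fB; near=> y.
have fy : row_free (rowsub (maxrankfun (A x)) (A y)) by near: y.
split=> //; apply/eqmxP; rewrite -(geq_leqif (mxrank_leqif_eq (rowsub_sub _ _))).
by move: (fy); rewrite /row_free => /eqP ->; near: y.
Unshelve. all: by end_near. Qed.

Lemma smooth_orthoproj x k m (A : M -> 'M[R]_(k, m)) : smooth_mx x A ->
  (\forall y \near x, (\rank (A y) <= \rank (A x))%N) ->
  smooth_mx x (fun y => orthoproj (A y)).
Proof.
move=> sA rA; have [g gP] := constant_rank_rows sA rA.
have sB : smooth_mx x (fun y => rowsub g (A y)).
  by move=> i j; under eq_fun do rewrite mxE; exact: sA.
have [fx _] := nbhs_singleton gP.
apply: smooth_mx_ext (smooth_projmx sB fx); apply: filterS gP => y [fy Ey].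
by rewrite (orthoprojE fy Ey).
Qed.

(** The Gram formula for c makes sense, and is smooth, whether or not u y lies in the row space;
    membership enters only in the identity, point by point. *)
Lemma smooth_coefficients x k m (A : M -> 'M[R]_(k, m)) (u : M -> 'rV[R]_m) :
  smooth_mx x A -> row_free (A x) -> smooth_mx x u ->
  exists2 c : M -> 'rV[R]_k, smooth_mx x c &
    \forall y \near x, (u y <= A y)%MS -> u y = c y *m A y.
Proof.
move=> sA fA su; pose G y := A y *m (A y)^T.
have sG : smooth_mx x G by apply: smooth_mx_mul => //; exact: smooth_mx_tr.
exists (fun y => u y *m (A y)^T *m invmx (G y)).
  apply: smooth_mx_mul; first by apply: smooth_mx_mul => //; exact: smooth_mx_tr.
  by apply: smooth_mx_inv => //; rewrite gram_unit.
have := near_row_free sA fA; apply: filterS => y fy uA.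
by rewrite -{1}(projmx_id fy uA) /projmx !mulmxA.
Qed.

End SmoothMatrices.

(** * Vector bundles in local frames *)

Section Coordinates.
Variables (R : realType) (vT : vectType R) (r : nat) (X : r.-tuple vT).
Implicit Types (v : vT) (W : {vspace vT}).

Definition coords v : 'rV[R]_r := \row_j coord X j v.

Definition lincomb (a : 'rV[R]_r) : vT := \sum_j a 0 j *: X`_j.

Lemma coords_is_linear : linear coords.
Proof. by move=> a u v; apply/rowP => j; rewrite !mxE linearP. Qed.
HB.instance Definition _ := GRing.isLinear.Build _ _ _ _ coords coords_is_linear.

Lemma lincomb_is_linear : linear lincomb.
Proof.
move=> a u v; rewrite /lincomb scaler_sumr -big_split /=; apply: eq_bigr => j _.
by rewrite !mxE scalerDl scalerA.
Qed.
HB.instance Definition _ := GRing.isLinear.Build _ _ _ _ lincomb lincomb_is_linear.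

Lemma coords_comb k (c : 'I_k -> vT) (a : 'I_k -> R) l :
  coords (\sum_i a i *: c i) 0 l = \sum_i a i * coords (c i) 0 l.
Proof.
rewrite linear_sum summxE; apply: eq_bigr => i _.
by rewrite linearZ mxE.
Qed.

(** Turns subspaces into row spaces, so that subspaces given by different spanning families can be
    compared with [:=:]. The rows come from an arbitrary basis and carry no smoothness in the base
    point. *)
Definition coords_mx W : 'M[R]_(\dim W, r) := \matrix_(i < \dim W) coords (vbasis W)`_i.

Hypothesis bX : basis_of fullv X.

Lemma lincomb_coords v : lincomb (coords v) = v.
Proof.
rewrite [RHS](coord_basis bX (memvf v)); apply: eq_bigr => j _.
by rewrite mxE.
Qed.

Lemma coords_lincomb a : coords (lincomb a) = a.
Proof.
by apply/rowP => j; rewrite mxE coord_sum_free //; exact: basis_free bX.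
Qed.

Lemma mulmx_coords k (c : 'I_k -> vT) (a : 'rV[R]_k) :
  a *m \matrix_i coords (c i) = coords (\sum_i a 0 i *: c i).
Proof.
rewrite mulmx_sum_row linear_sum; apply: eq_bigr => i _.
by rewrite rowK linearZ.
Qed.

Lemma mem_coords_mx W v : (coords v <= coords_mx W)%MS = (v \in W).
Proof.
apply/idP/idP => [/submxP[D]|vW].
  rewrite mulmx_coords => /(can_inj lincomb_coords) ->.
  by apply: memv_suml => i _; apply: memvZ; apply: vbasis_mem; rewrite mem_nth ?size_tuple.
rewrite (coord_vbasis vW) linear_sum; apply: summx_sub => i _.
by rewrite linearZ scalemx_sub // -[X in (X <= _)%MS](rowK (fun i => coords (vbasis W)`_i)) row_sub.
Qed.

Lemma mem_lincomb W a : (a <= coords_mx W)%MS = (lincomb a \in W).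
Proof. by rewrite -mem_coords_mx coords_lincomb. Qed.

Lemma eqmx_rowP m n (A : 'M[R]_(m, r)) (B : 'M[R]_(n, r)) :
  (forall a : 'rV[R]_r, (a <= A)%MS = (a <= B)%MS) -> (A :=: B)%MS.
Proof.
move=> AB; apply/eqmxP/andP; split; apply/row_subP => i.
  by rewrite -AB row_sub.
by rewrite AB row_sub.
Qed.

Lemma span_coords_mx k (c : 'I_k -> vT) W : (forall i, c i \in W) ->
  (forall v, v \in W -> exists a : 'rV[R]_k, v = \sum_i a 0 i *: c i) ->
  (\matrix_i coords (c i) :=: coords_mx W)%MS.
Proof.
move=> cW Wc; apply: eqmx_rowP => a; rewrite mem_lincomb.
apply/idP/idP => [/submxP[D ->]|/Wc[b E]].
  by rewrite mulmx_coords lincomb_coords; apply: memv_suml => i _; exact: memvZ.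
by rewrite -(coords_lincomb a) E -mulmx_coords submxMl.
Qed.

Lemma basis_coords_mx W k (c : 'I_k -> vT) : basis_of W [tuple c i | i < k] ->
  (\matrix_i coords (c i) :=: coords_mx W)%MS.
Proof.
move=> bW; apply: span_coords_mx => [i|v vW].
  by apply: (basis_mem bW); apply/mapP; exists i; rewrite ?mem_enum.
exists (\row_i coord [tuple c i | i < k] i v).
rewrite {1}(coord_basis bW vW); apply: eq_bigr => i _.
by rewrite mxE -tnth_nth tnth_mktuple.
Qed.

Lemma rank_coords_mx W : \rank (coords_mx W) = \dim W.
Proof.
apply/eqP; rewrite -[_ == _]/(row_free _); apply: inj_row_free => a.
rewrite mulmx_coords => a0; have {a0} : \sum_i a 0 i *: (vbasis W)`_i = 0.
  by rewrite -[LHS]lincomb_coords a0 linear0.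
have /freeP H := basis_free (vbasisP W).
by move=> /H a0; apply/rowP => i; rewrite a0 mxE.
Qed.

Lemma basis_fromP W k (c : 'I_k -> vT) (A : 'M[R]_(k, r)) :
  (forall i, row i A = coords (c i)) -> row_free A -> (A :=: coords_mx W)%MS ->
  basis_of W [tuple c i | i < k].
Proof.
move=> Ac fA AW.
have sW : {subset [tuple c i | i < k] <= W}.
  by move=> _ /mapP[i _ ->]; rewrite -mem_coords_mx -AW -Ac row_sub.
rewrite basisEdim; apply/andP; split; last first.
  by rewrite size_tuple -rank_coords_mx -AW; move: fA; rewrite /row_free => /eqP ->.
apply/subvP => v; rewrite -mem_coords_mx -AW => /submxP[D].
have -> : A = \matrix_i coords (c i) by apply/row_matrixP => i; rewrite rowK.
rewrite mulmx_coords => /(can_inj lincomb_coords) ->.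
apply: memv_suml => i _; apply: memvZ; apply: memv_span.
by apply/mapP; exists i => //; rewrite mem_enum.
Qed.

End Coordinates.

Section QuotientProjection.
Variables (R : realType) (M : manifold R) (B : bundle M).
Variables (U V : forall x, {vspace B x}).
Implicit Types x : M.

Lemma val_qproj x e : vsval (qproj U V x e) = addv_pi1 (U x) (V x) e.
Proof. by rewrite /qproj comp_lfunE lfunE /= vsprojK //; exact: memv_pi. Qed.

Lemma qproj_mem x e : vsval (qproj U V x e) \in U x.
Proof. by rewrite val_qproj memv_pi1. Qed.

Lemma qproj_sub x e : e \in U x -> e - vsval (qproj U V x e) \in V x.
Proof.
move=> eU; have eUV : e \in (U x + V x)%VS by exact: (subvP (addvSl _ _)).
by rewrite val_qproj -{1}(addv_pi1_pi2 eUV) addrC addKr memv_pi2.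
Qed.

Lemma qproj_id x (a : subvs_of (U x :\: V x)) : qproj U V x (vsval a) = a.
Proof.
apply/val_inj; rewrite /= val_qproj; apply: daddv_pi_id (subvsP a).
exact: capv_diff.
Qed.

Lemma qproj_eq0 x e : e \in V x -> qproj U V x e = 0.
Proof.
move=> eV; have eUV : e \in (U x + V x)%VS by exact: (subvP (addvSr _ _)).
have p0 : addv_pi1 (U x) (V x) e = 0.
  by apply: (addIr (addv_pi2 (U x) (V x) e)); rewrite addv_pi1_pi2 // add0r addv_pi2_id.
by apply/val_inj; rewrite /= val_qproj p0; exact: (esym (linear0 vsval)).
Qed.

End QuotientProjection.

Section LocalFrames.
Context {R : realType}.
Implicit Types M N : manifold R.

Definition local_frame M (B : bundle M) (U : set M) r (e : 'I_r -> section B) :=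
  [/\ open U, (forall y, U y -> basis_of fullv (frame e y)) &
      forall y (s : section B), U y -> (smooth_at y s <->
        smooth_mx y (fun z => coords (frame e z) (s z)))].

Lemma frame_nth M (B : bundle M) r (e : 'I_r -> section B) y (j : 'I_r) :
  (frame e y)`_j = e j y.
Proof. by rewrite -tnth_nth tnth_mktuple. Qed.

Lemma lincomb_frame M (B : bundle M) r (e : 'I_r -> section B) y a :
  lincomb (frame e y) a = \sum_j a 0 j *: e j y.
Proof. by apply: eq_bigr => j _; rewrite frame_nth. Qed.

Lemma smooth_rowP M (x : M) r (a : M -> 'rV[R]_r) :
  smooth_mx x a <-> forall j, smooth_fun_at x (fun y => a y 0 j).
Proof. by split=> [sa j|sa i j]; [exact: sa|rewrite ord1; exact: sa]. Qed.

Lemma vbundle_frame M (B : bundle M) x : is_vbundle B ->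
  exists U r (e : 'I_r -> section B), U x /\ local_frame U e.
Proof.
move=> /(_ x)[U [r [e [oU Ux bU sU]]]]; exists U, r, e; split=> //; split=> // y s Uy.
rewrite smooth_rowP (sU y s Uy).
have E j : (fun z => coords (frame e z) (s z) 0 j) = (fun z => coord (frame e z) j (s z)).
  by apply/funext => z; rewrite mxE.
by split=> H j; have := H j; rewrite E.
Qed.

Lemma near_smooth_mx M (x : M) m n (A : M -> 'M[R]_(m, n)) :
  smooth_mx x A -> \forall y \near x, smooth_mx y A.
Proof.
move=> sA; have H : \forall y \near x, forall ij : 'I_m * 'I_n,
    smooth_fun_at y (fun z => A z ij.1 ij.2).
  apply: (@filter_forall _ _ _ (nbhs x)) => -[i j] /=.
  exact: smooth_fun_at_near (sA i j).
by apply: filterS H => y H i j; exact: (H (i, j)).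
Qed.

Section Frame.
Variables (M : manifold R) (B : bundle M) (U : set M) (r : nat).
Variable e : 'I_r -> section B.
Hypothesis lf : local_frame U e.

Lemma frame_near x : U x -> \forall y \near x, U y.
Proof. by case: lf => oU _ _ Ux; apply: open_nbhs_nbhs. Qed.

Lemma frame_basis y : U y -> basis_of fullv (frame e y).
Proof. by case: lf => _ + _; exact. Qed.

Lemma frame_smoothP y (s : section B) : U y ->
  smooth_at y s <-> smooth_mx y (fun z => coords (frame e z) (s z)).
Proof. by case: lf => _ _; exact. Qed.

Lemma smooth_lincomb y (a : M -> 'rV[R]_r) : U y -> smooth_mx y a ->
  smooth_at y (fun z => lincomb (frame e z) (a z)).
Proof.
move=> Uy sa; apply/(frame_smoothP _ Uy); apply: smooth_mx_ext sa.
by have := frame_near Uy; apply: filterS => z Uz; rewrite coords_lincomb //; exact: frame_basis.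
Qed.

Lemma frame_smooth y j : U y -> smooth_at y (e j).
Proof.
move=> Uy; apply/(frame_smoothP _ Uy).
apply: (@smooth_mx_ext _ _ _ _ _ (fun=> delta_mx 0 j)); last exact: smooth_mx_cst.
have := frame_near Uy; apply: filterS => z Uz; rewrite -[LHS](coords_lincomb (frame_basis Uz)).
congr (coords _ _); rewrite lincomb_frame (bigD1 j) //= big1 => [|k kj].
  by rewrite mxE !eqxx scale1r addr0.
by rewrite mxE (negPf kj) andbF scale0r.
Qed.

End Frame.

Section VectorBundle.
Variables (M : manifold R) (B : bundle M).
Hypothesis vB : is_vbundle B.
Implicit Types (x : M) (s t : section B).

Lemma smooth_at_ext x s t : (\forall y \near x, s y = t y) ->
  smooth_at x s -> smooth_at x t.
Proof.
have [U [r [e [Ux lf]]]] := vbundle_frame x vB => st.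
move=> /(frame_smoothP lf _ Ux) ss; apply/(frame_smoothP lf _ Ux).
by apply: smooth_mx_ext ss; apply: filterS st => y ->.
Qed.

Lemma smooth_at_near x s : smooth_at x s -> \forall y \near x, smooth_at y s.
Proof.
have [U [r [e [Ux lf]]]] := vbundle_frame x vB.
move=> /(frame_smoothP lf _ Ux)/near_smooth_mx ss; have nU := frame_near lf Ux.
near=> y; have Uy : U y by near: y.
by apply/(frame_smoothP lf _ Uy); near: y.
Unshelve. all: by end_near. Qed.

Lemma smooth_at_comb x m (g : 'I_m -> M -> R) (s : 'I_m -> section B) :
  (forall j, smooth_fun_at x (g j)) -> (forall j, smooth_at x (s j)) ->
  smooth_at x (fun y => \sum_j g j y *: s j y).
Proof.
have [U [r [e [Ux lf]]]] := vbundle_frame x vB => sg ss.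
apply/(frame_smoothP lf _ Ux); apply/smooth_rowP => l.
have -> : (fun y => coords (frame e y) (\sum_j g j y *: s j y) 0 l) =
    (fun y => \sum_j g j y * coords (frame e y) (s j y) 0 l).
  by apply/funext => y; rewrite coords_comb.
apply: smooth_fun_at_sum => j _; apply: smooth_fun_atM => //.
by have /(frame_smoothP lf _ Ux)/smooth_rowP := ss j; exact.
Qed.

Lemma smooth_atZ x (g : M -> R) s : smooth_fun_at x g -> smooth_at x s ->
  smooth_at x (fun y => g y *: s y).
Proof.
move=> sg ss; have := @smooth_at_comb x 1 (fun=> g) (fun=> s) (fun=> sg) (fun=> ss).
by apply: smooth_at_ext; apply: nearW => y; rewrite big_ord1.
Qed.

Lemma smooth_at0 x : smooth_at x (fun y => 0 : B y).
Proof.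
have := @smooth_at_comb x 0 (fun=> (fun=> 0)) (fun=> (fun=> 0)).
have h0 (P : 'I_0 -> Prop) : forall j, P j by case.
move=> /(_ (h0 _) (h0 _)); apply: smooth_at_ext.
by apply: nearW => y; rewrite big_ord0.
Qed.

End VectorBundle.

Section Pullback.
Variables (M N : manifold R) (f : M -> N) (B : bundle N).
Hypothesis sf : smooth_map f.

Lemma smooth_mx_comp x m n (A : N -> 'M[R]_(m, n)) :
  smooth_mx (f x) A -> smooth_mx x (fun y => A (f y)).
Proof. by move=> sA i j; exact: (smooth_map_comp sf (sA i j)). Qed.

(** One direction computes the coordinates of a combination of sections t_j o f; in the other, the
    frame with the coordinates as coefficients is itself such a combination. *)
Lemma pull_frame (U : set N) r (e : 'I_r -> section B) : local_frame U e ->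
  local_frame (B := pull f B) (f @^-1` U) (fun j x => e j (f x)).
Proof.
move=> lf; have [cf _] := sf; have [oU bU _] := lf.
have oV : open (f @^-1` U) by apply: open_comp => // x _; exact: cf.
split=> // [x Ux|x s Ux]; first exact: bU.
have nV : \forall y \near x, U (f y) by apply: open_nbhs_nbhs.
split=> [[m [t [g [st sg E]]]]|ss].
  apply/smooth_rowP => l.
  have sc : smooth_fun_at x (fun y => \sum_j g j y * coords (frame e (f y)) (t j (f y)) 0 l).
    apply: smooth_fun_at_sum => j _; apply: smooth_fun_atM => //.
    have /(frame_smoothP lf _ Ux)/smooth_rowP/(_ l) := st j.
    exact: (smooth_map_comp sf).
  apply: smooth_fun_at_ext sc; apply: filterS E => y ->.
  exact: (esym (coords_comb (frame e (f y)) (fun j => t j (f y)) (g^~ y) l)).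
exists r, e, (fun j y => coords (frame e (f y)) (s y) 0 j); split=> [j|j|].
- exact: frame_smooth lf _ _ Ux.
- by move/smooth_rowP: ss; exact.
apply: filterS nV => y Uy; rewrite -lincomb_frame lincomb_coords //.
exact: frame_basis lf _ Uy.
Qed.

Lemma pull_vbundle : is_vbundle B -> is_vbundle (pull f B).
Proof.
move=> vB x; have [U [r [e [Ux lf]]]] := vbundle_frame (f x) vB.
have [oV bV sV] := pull_frame lf.
exists (f @^-1` U), r, (fun j x => e j (f x)); split=> // y s Uy.
rewrite (sV y s Uy) smooth_rowP.
pose e' : 'I_r -> section (pull f B) := fun j x => e j (f x); rewrite -/e'.
have E j : (fun z => coords (frame e' z) (s z) 0 j) = (fun z => coord (frame e' z) j (s z)).
  by apply/funext => z; rewrite mxE.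
by split=> H j; have := H j; rewrite E.
Qed.

Lemma smooth_at_pull x (s : section B) : smooth_at (f x) s ->
  smooth_at (b := pull f B) x (fun y => s (f y)).
Proof.
move=> ss; exists 1%N, (fun=> s), (fun _ _ => 1); split=> // [j|].
  exact: smooth_fun_at_cst.
by apply: nearW => y; rewrite big_ord1 scale1r.
Qed.

(** In u = sum g_j (t_j o f) the sections t_j already live on the target, so only the functions g_j
    have to be extended. *)
Lemma extend_section x (u : section (pull f B)) : is_vbundle B ->
  injective (@tmap R M N f x) -> smooth_at x u ->
  exists2 t : section B, smooth_at (f x) t & \forall y \near x, t (f y) = u y.
Proof.
move=> vB inj [m [t [g [st sg E]]]].
have /choice[G HG] j : exists G, smooth_fun_at (f x) G /\
    \forall y \near x, G (f y) = g j y.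
  by have [G sG EG] := smooth_extension sf inj (sg j); exists G.
exists (fun z => \sum_j G j z *: t j z).
  by apply: smooth_at_comb => // j; have [] := HG j.
have nG : \forall y \near x, forall j, G j (f y) = g j y.
  by apply: (@filter_forall _ _ _ (nbhs x)) => j; have [] := HG j.
near=> y; have -> : u y = \sum_j g j y *: t j (f y) by near: y.
by apply: eq_bigr => j _; congr (_ *: _); move: j; near: y.
Unshelve. all: by end_near. Qed.

End Pullback.

End LocalFrames.

(** * Subbundles and their local frames *)

Section Subbundles.
Context {R : realType}.
Implicit Types M N S : manifold R.

Lemma embedding_open M N (i : N -> M) (x : N) (P : N -> Prop) : embedding i ->
  (\forall y \near x, P y) ->
  exists V : set M, [/\ open V, V (i x) & forall y, V (i y) -> P y].
Proof.
move=> [_ _ _ ei]; rewrite /prop_near1 nbhsE => -[W [oW Wx] WP].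
have [V oV WV] := ei W oW; exists V; split=> //; first by rewrite WV in Wx.
by move=> y Vy; apply: WP; rewrite WV.
Qed.

Lemma near_open (T : topologicalType) (x : T) (P : T -> Prop) :
  (\forall y \near x, P y) -> exists V : set T, [/\ open V, V x & V `<=` P].
Proof. by rewrite /prop_near1 nbhsE => -[V [oV Vx] VP]; exists V. Qed.

(** The extensions agree with the frame of L only near s0 in S. Since S is embedded, V can be chosen
    to meet S only there, so the basis property holds at every point of S in V. *)
Lemma extend_frame M S (B : bundle M) (iS : S -> M) (L : forall x, {vspace B x})
    (s0 : S) : is_vbundle B -> embedding iS ->
  is_subbundle (B := pull iS B) (fun s => L (iS s)) ->
  exists (V : set M) k (l : 'I_k -> section B), [/\ open V, V (iS s0),
    (forall j, secs V (l j)) &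
    forall s, V (iS s) -> basis_of (L (iS s)) (frame l (iS s))].
Proof.
move=> vB emb /(_ s0)[U [k [e [oU Us0 se bU]]]]; have [sm _ inj _] := emb.
have /choice[l Hl] j : exists t : section B, smooth_at (iS s0) t /\
    \forall s \near s0, t (iS s) = e j s.
  by have [t st E] := extend_section sm vB (inj s0) (se j s0 Us0); exists t.
have n1 : \forall s \near s0, U s /\ forall j, l j (iS s) = e j s.
  have n : \forall s \near s0, forall j, l j (iS s) = e j s.
    by apply: (@filter_forall _ _ _ (nbhs s0)) => j; have [] := Hl j.
  have nU : \forall s \near s0, U s by apply: open_nbhs_nbhs.
  by apply: filterS2 nU n.
have [V1 [oV1 V1s HV1]] := embedding_open emb n1.
have n2 : \forall y \near iS s0, forall j, smooth_at y (l j).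
  apply: (@filter_forall _ _ _ (nbhs (iS s0))) => j; have [sl _] := Hl j.
  exact: smooth_at_near.
have [V2 [oV2 V2s HV2]] := near_open n2.
exists (V1 `&` V2), k, l; split; [exact: openI|by []|by move=> j y [_ /HV2]|].
move=> s [/HV1[Us E] _]; have -> : frame l (iS s) = frame e s.
  by apply: eq_from_tnth => j; rewrite !tnth_mktuple.
exact: bU.
Qed.

(** A maximal independent set of rows of P at x stays a basis of the row space nearby, because the
    rank is constant. *)
Lemma row_space_frame M (B : bundle M) (U : set M) r (t : 'I_r -> section B)
    (L : forall x, {vspace B x}) (P : M -> 'M[R]_r) x :
  local_frame U t -> U x -> (forall y, U y -> smooth_mx y P) ->
  (forall y, U y -> (P y :=: coords_mx (frame t y) (L y))%MS) ->
  (forall y, U y -> \dim (L y) = \dim (L x)) ->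
  exists (W : set M) k (A : M -> 'M[R]_(k, r)), [/\ open W, W x & forall y, W y ->
    [/\ U y, smooth_mx y A, row_free (A y), (A y :=: coords_mx (frame t y) (L y))%MS &
        basis_of (L y) (frame (fun j z => lincomb (frame t z) (row j (A z))) y)]].
Proof.
move=> lf Ux sP PL dL.
have rk y : U y -> \rank (P y) = \dim (L x).
  by move=> Uy; rewrite PL // rank_coords_mx ?dL //; exact: frame_basis lf _ Uy.
have nr : \forall y \near x, (\rank (P y) <= \rank (P x))%N.
  by have := frame_near lf Ux; apply: filterS => y Uy; rewrite !rk.
have [g gP] := constant_rank_rows (sP x Ux) nr.
have [W [oW Wx HW]] := near_open (filterI (frame_near lf Ux) gP).
exists W, (\rank (P x)), (fun y => rowsub g (P y)); split=> // y /HW[Uy [fA EA]].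
have bt := frame_basis lf Uy; have AL := eqmx_trans EA (PL y Uy).
split=> //; first by move=> j l; under eq_fun do rewrite mxE; exact: sP.
by apply: (basis_fromP bt _ fA AL) => j; rewrite coords_lincomb.
Qed.

Lemma smooth_row_lincomb M (B : bundle M) (U : set M) r (t : 'I_r -> section B) k
    (A : M -> 'M[R]_(k, r)) (j : 'I_k) y : local_frame U t -> U y ->
  smooth_mx y A -> smooth_at y (fun z => lincomb (frame t z) (row j (A z))).
Proof.
move=> lf Uy sA; apply: (smooth_lincomb lf Uy) => a l.
by under eq_fun do rewrite mxE; exact: sA.
Qed.

Lemma subbun_vbundle M (B : bundle M) (L : forall x, {vspace B x}) :
  is_vbundle B ->
  (forall x, exists (U : set M) r (t : 'I_r -> section B) (P : M -> 'M[R]_r),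
    [/\ local_frame U t, U x, (forall y, U y -> smooth_mx y P),
      (forall y, U y -> (P y :=: coords_mx (frame t y) (L y))%MS) &
      (forall y, U y -> \dim (L y) = \dim (L x))]) ->
  is_vbundle (subbun L).
Proof.
move=> vB H x; have [U [r [t [P [lf Ux sP PL dL]]]]] := H x.
have [W [k [A [oW Wx HW]]]] := row_space_frame lf Ux sP PL dL.
pose g j y := lincomb (frame t y) (row j (A y)).
pose e (j : 'I_k) : section (subbun L) := fun y => vsproj (L y) (g j y).
have eK j y : W y -> vsval (e j y) = g j y.
  move=> /HW[_ _ _ _ b]; apply: vsprojK.
  by apply: (basis_mem b); apply/mapP; exists j; rewrite ?mem_enum.
have be y : W y -> basis_of fullv (frame e y).
  move=> Wy; have [_ _ _ _ b] := HW y Wy; rewrite basisEfree; apply/and3P; split.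
  - apply/freeP => a a0; have /freeP := basis_free b; apply.
    apply: etrans (linear0 (@vsval R (B y) (L y))).
    rewrite -a0 linear_sum; apply: eq_bigr => j _.
    rewrite linearZ !(frame_nth (B := B)) (frame_nth (B := subbun L)).
    by congr (_ *: _); rewrite -[RHS]/(vsval (e j y)) eK.
  - exact: subvf.
  - by rewrite size_tuple dimvf /dim /= (size_basis b).
exists W, k, e; split=> // y s Wy; have [Uy sA fA _ b] := HW y Wy.
have nW : \forall z \near y, W z by apply: open_nbhs_nbhs.
split=> [ss|sc].
- have /(frame_smoothP lf _ Uy) su : smooth_at y (fun z => vsval (s z) : B z) by [].
  have [c sc E] := smooth_coefficients sA fA su.
  suff n j : \forall z \near y, c z 0 j = coord (frame e z) j (s z).
    move=> j; apply: smooth_fun_at_ext (n j) _.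
    by have /smooth_rowP := sc; exact.
  near=> z; have Wz : W z by near: z.
  have [Uz _ fz AL bz] := HW z Wz; have bt := frame_basis lf Uz.
  have Az : (coords (frame t z) (vsval (s z)) <= A z)%MS.
    by rewrite AL mem_coords_mx // subvsP.
  have Ez : coords (frame t z) (vsval (s z)) = c z *m A z by move: Az; near: z.
  have sz : s z = \sum_l c z 0 l *: e l z.
    apply: val_inj; rewrite -[LHS](lincomb_coords bt) Ez mulmx_sum_row !linear_sum.
    by apply: eq_bigr => l _; rewrite !linearZ -[RHS]/(_ *: vsval (e l z)) eK.
  rewrite sz -(lincomb_frame e z) -[RHS]/(coord _ _ _).
  by have := congr1 (fun u : 'rV_k => u 0 j) (coords_lincomb (be z Wz) (c z)); rewrite mxE => ->.
- have ss : smooth_at y (fun z => \sum_j coord (frame e z) j (s z) *: g j z).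
    by apply: smooth_at_comb => // j; exact: (smooth_row_lincomb _ lf Uy sA).
  apply: (smooth_at_ext vB _ ss); apply: filterS nW => z Wz.
  rewrite [in RHS](coord_basis (be z Wz) (memvf (s z))) linear_sum.
  apply: eq_bigr => j _; rewrite linearZ (frame_nth (B := subbun L)).
  by congr (_ *: _); rewrite -[RHS]/(vsval (e j z)) eK.
Unshelve. all: by end_near. Qed.

End Subbundles.

(** * The pairing in a local frame *)

Section Forms.
Context {R : realType} (M : manifold R) (E : courant M).

Definition form_mx r (f : 'I_r -> section E) y : 'M[R]_r :=
  \matrix_(j, l) cform E y (f j y) (f l y).

Lemma form_mxE (U : set M) r (f : 'I_r -> section E) y (u v : E y) :
  local_frame U f -> U y ->
  cform E y u v = (coords (frame f y) u *m form_mx f y *m (coords (frame f y) v)^T) 0 0.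
Proof.
move=> lf Uy; have bf := frame_basis lf Uy.
rewrite -{1}(lincomb_coords bf u) -{1}(lincomb_coords bf v) !lincomb_frame linear_sumlz.
under eq_bigr => j _ do rewrite linear_sumr.
rewrite exchange_big !mxE /=; apply: eq_bigr => l _.
rewrite !mxE mulr_suml; apply: eq_bigr => j _.
by rewrite linearZr_LR linearZl_LR /= !mxE mulrC.
Qed.

Lemma form_mx_tr r (f : 'I_r -> section E) y : (form_mx f y)^T = form_mx f y.
Proof. by apply/matrixP => j l; rewrite !mxE symmetricC. Qed.

Lemma form_mx_free (U : set M) r (f : 'I_r -> section E) y :
  local_frame U f -> U y -> row_free (form_mx f y).
Proof.
move=> lf Uy; have bf := frame_basis lf Uy; apply: inj_row_free => a a0.
rewrite -(coords_lincomb bf a); suff -> : lincomb (frame f y) a = 0 by rewrite linear0.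
apply: (nondegenerate_eq0 (@c_nondegenerate _ _ E y)) => v.
by rewrite (form_mxE _ _ lf Uy) coords_lincomb // a0 mul0mx mxE.
Qed.

Lemma mem_orthov_mx (U : set M) r (f : 'I_r -> section E) y k (A : 'M[R]_(k, r))
    (W : {vspace E y}) (u : E y) : local_frame U f -> U y ->
  (A :=: coords_mx (frame f y) W)%MS ->
  (u \in orthov (cform E y) W) = (coords (frame f y) u *m (A *m form_mx f y)^T == 0).
Proof.
move=> lf Uy AW; have bf := frame_basis lf Uy.
rewrite trmx_mul form_mx_tr mulmxA; apply/mem_orthovP/eqP => [H|u0 w wW].
  apply/rowP => j; rewrite [RHS]mxE.
  have wW : lincomb (frame f y) (row j A) \in W by rewrite -mem_lincomb // -AW row_sub.
  have := H _ wW; rewrite (form_mxE _ _ lf Uy) coords_lincomb // => <-.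
  by rewrite !mxE; apply: eq_bigr => l _; rewrite !mxE.
have /submxP[D E0] : (coords (frame f y) w <= A)%MS by rewrite AW mem_coords_mx.
by rewrite (form_mxE _ _ lf Uy) E0 trmx_mul mulmxA u0 mul0mx mxE.
Qed.

End Forms.

(** * The reduced Dirac structure *)

Section FlatConnections.
Context {R : realType} (N : manifold R) (A : bundle N).
Variables (F : forall x : N, {vspace tangent x}) (nab : connection_op A).
Hypothesis nabF : flat_Fconnection F nab.
Hypothesis smooth_combA : forall m (g : 'I_m -> N -> R) (s : 'I_m -> section A) x,
  (forall j, smooth_fun_at x (g j)) -> (forall j, smooth_at x (s j)) ->
  smooth_at x (fun y => \sum_j g j y *: s j y).

Lemma connection_comb (W : set N) Y m (g : 'I_m -> N -> R) (s : 'I_m -> section A) x :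
  open W -> subsecs (B := tbun N) F W Y -> W x ->
  (forall j, smooth_fun_on W (g j)) -> (forall j, secs W (s j)) ->
  nab Y (fun y => \sum_j g j y *: s j y) x =
  \sum_j (g j x *: nab Y (s j) x + dirder x (Y x) (g j) *: s j x).
Proof.
move=> oW YF Wx; have [_ ext _ leib _] := nabF oW.
elim: m g s => [|m IH] g s sg ss.
  (* The empty sum is the zero section z. Leibniz for 1 z + z, which equals z, reads nab z = nab z +
     nab z and forces nab z = 0. *)
  set z := fun y => _.
  have sz : secs W z by move=> y _; apply: smooth_combA => - [].
  have z0 y : z y = 0 by rewrite /z big_ord0.
  have s1 : secs W (fun y => 1 *: z y + z y).
    move=> y Wy; have -> : (fun y => 1 *: z y + z y) = z; last exact: sz.
    by apply: functional_extensionality_dep => u; rewrite scale1r z0 addr0.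
  have := leib (fun=> 1) Y z z (fun y _ => smooth_fun_at_cst y 1) YF sz sz x Wx.
  have -> : nab Y (fun y => 1 *: z y + z y) x = nab Y z x.
    by apply: (ext Y Y _ _ YF YF s1 sz) => // y _; split=> //; rewrite scale1r z0 addr0.
  rewrite dirder_cst scale1r scale0r addr0 big_ord0 => /eqP.
  by rewrite -subr_eq subrr eq_sym => /eqP.
have -> : (fun y => \sum_(j < m.+1) g j y *: s j y) =
    (fun y => g ord0 y *: s ord0 y + \sum_(j < m) g (lift ord0 j) y *: s (lift ord0 j) y).
  by apply: functional_extensionality_dep => y; rewrite big_ord_recl.
rewrite big_ord_recl leib //; first by rewrite IH.
by move=> y Wy; apply: smooth_combA => j; [exact: sg|exact: ss].
Qed.

End FlatConnections.

(** * The image of L_quot in the reduced bundle *)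

Section ReducedDirac.
Context {R : realType} (M : manifold R) (E : courant M) (N : manifold R) (i : N -> M).
Variable K : forall x : N, {vspace E (i x)}.
Variables (S : manifold R) (iS : S -> M) (L : forall x : M, {vspace E x}).
Hypothesis ei : embedding i.
Hypothesis sK : is_subbundle (B := pull i E) K.
Hypothesis KK : forall x, (K x <= perp K x)%VS.
Hypothesis eS : embedding iS.
Hypothesis rS : range i `<=` range iS.
Hypothesis dL : is_dirac iS L.
Hypothesis rk : exists r : nat, forall x : N, \dim (L (i x) :&: K x) = r.

Lemma lagrangian_on_N x : L (i x) = orthov (cform E (i x)) (L (i x)).
Proof.
(* Fibres depend on the point, so the equation i x = iS s is used only after generalising to an
   arbitrary point z of the image of S. The same device recurs below. *)
have [_ lagr _ _] := dL; suff H z : range iS z -> L z = orthov (cform E z) (L z).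
  by apply: H; apply: rS; exists x.
by move=> [s _ <-]; exact: lagr.
Qed.

(* K^perp /\ L|_N is the orthogonal complement of K + L|_N, which has constant
   rank by assumption (a). *)
Lemma perp_cap_span x0 : exists (W : set N) n (q : 'I_n -> section (pull i E)),
  [/\ open W, W x0 & forall y, W y -> [/\ forall j, smooth_at y (q j),
    forall j, q j y \in (perp K y :&: L (i y))%VS &
    forall v, v \in (perp K y :&: L (i y))%VS ->
      exists a : 'rV[R]_n, v = \sum_j a 0 j *: q j y]].
Proof.
have si : smooth_map i by case: ei.
have [s0 _ Es] : range iS (i x0) by apply: rS; exists x0.
have [sL _ _ _] := dL.
have [V [b [l [oV Vx sl bl]]]] := extend_frame s0 (c_vbundle E) eS sL.
rewrite Es in Vx.
have {}bl y : V (i y) -> basis_of (L (i y)) (frame l (i y)).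
  have H z : range iS z -> V z -> basis_of (L z) (frame l z).
    by move=> [s _ <-]; exact: bl.
  by apply: H; apply: rS; exists y.
have [U [n [f [Ux lf]]]] := vbundle_frame (i x0) (c_vbundle E).
have lfN := pull_frame si lf.
have [UK [a [k [oK Kx sk bk]]]] := sK x0.
have ci : continuous i by case: si.
have oVN : open (i @^-1` V) by apply: open_comp => // x _; exact: ci.
have oUN : open (i @^-1` U) by have [] := lfN.
pose W := (i @^-1` U) `&` (i @^-1` V) `&` UK.
have oW : open W by apply: openI => //; exact: openI.
pose AK y := \matrix_(j < a) coords (frame f (i y)) (k j y).
pose AL y := \matrix_(j < b) coords (frame f (i y)) (l j (i y)).
pose A y := col_mx (AK y) (AL y).
have sA y : W y -> smooth_mx y A.
  move=> [[Uy Vy] UKy] j c; case: (split_ordP j) => j' ->.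
    have E0 : (fun z => A z (lshift b j') c) = (fun z => coords (frame f (i z)) (k j' z) 0 c).
      by apply/funext => z; rewrite col_mxEu mxE.
    rewrite E0; have /(frame_smoothP lfN _ Uy)/smooth_rowP := sk j' y UKy.
    exact.
  have E0 : (fun z => A z (rshift a j') c) = (fun z => coords (frame f (i z)) (l j' (i z)) 0 c).
    by apply/funext => z; rewrite col_mxEd mxE.
  rewrite E0; have := smooth_at_pull (f := i) (sl j' _ Vy).
  by move=> /(frame_smoothP lfN _ Uy)/smooth_rowP; exact.
have AE y : W y -> (A y :=: coords_mx (frame f (i y)) (K y + L (i y)))%MS.
  move=> [[Uy Vy] UKy]; have bf := frame_basis lf Uy.
  have EK : (AK y :=: coords_mx (frame f (i y)) (K y))%MS := basis_coords_mx bf (bk y UKy).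
  have EL : (AL y :=: coords_mx (frame f (i y)) (L (i y)))%MS := basis_coords_mx bf (bl y Vy).
  apply: (eqmx_rowP) => u; rewrite mem_lincomb // -addsmxE.
  apply/sub_addsmxP/memv_addP => [[[u1 u2] /= ->]|[v vK [w wL Eu]]].
    exists (lincomb (frame f (i y)) (u1 *m AK y)).
      by rewrite -mem_lincomb // -EK submxMl.
    exists (lincomb (frame f (i y)) (u2 *m AL y)); last by rewrite linearD.
    by rewrite -mem_lincomb // -EL submxMl.
  have /submxP[D1 E1] : (coords (frame f (i y)) v <= AK y)%MS by rewrite EK mem_coords_mx.
  have /submxP[D2 E2] : (coords (frame f (i y)) w <= AL y)%MS by rewrite EL mem_coords_mx.
  by exists (D1, D2); rewrite -[LHS](coords_lincomb bf) Eu linearD; congr (_ + _).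
(* Assumption (a) enters here: K and L have local ranks a and b, so K + L has rank a + b - r. *)
have [r rkr] := rk.
have rkA y : W y -> \rank (A y) = (a + b - r)%N.
  move=> Wy; have [[Uy Vy] UKy] := Wy; have bf := frame_basis lf Uy.
  rewrite AE // rank_coords_mx // -(rkr y) capvC.
  by rewrite -(size_basis (bk y UKy)) -(size_basis (bl y Vy)) -dimv_sum_cap addnK.
(* The rows of B are the functionals obtained by pairing with a spanning family of K + L; their
   common kernel is K^perp /\ L. *)
pose B y := A y *m form_mx f (i y).
have sB y : W y -> smooth_mx y B.
  move=> Wy; apply: smooth_mx_mul; first exact: sA.
  have [[Uy _] _] := Wy; apply: (smooth_mx_comp si) => j c.
  under eq_fun do rewrite mxE.
  by apply: cform_smooth; exact: frame_smooth lf _ _ Uy.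
have rkB y : W y -> \rank (B y) = (a + b - r)%N.
  move=> Wy; rewrite mxrankMfree ?rkA //; have [[Uy _] _] := Wy.
  exact: form_mx_free lf Uy.
(* A coordinate row belongs to K^perp /\ L exactly when it is fixed by Q, so the rows of Q span it.
   They need not be independent. *)
pose Q y := 1%:M - orthoproj (B y).
have sQ y : W y -> smooth_mx y Q.
  move=> Wy; apply: smooth_mxB; first exact: smooth_mx_cst.
  apply: smooth_orthoproj; first exact: sB.
  have nW : \forall z \near y, W z by apply: open_nbhs_nbhs.
  by apply: filterS nW => z Wz; rewrite !rkB.
exists W, n, (fun j y => lincomb (frame f (i y)) (row j (Q y))); split=> // y Wy.
have [[Uy Vy] UKy] := Wy; have bf := frame_basis lf Uy.
have memP v : (v \in (perp K y :&: L (i y))%VS) =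
    (coords (frame f (i y)) v *m orthoproj (B y) == 0).
  rewrite {1}lagrangian_on_N /perp -orthov_add -orthoproj_ker.
  exact: (mem_orthov_mx _ lf Uy (AE y Wy)).
split.
- by move=> j; exact: (smooth_row_lincomb (B := pull i E) j lfN Uy (sQ y Wy)).
- move=> j; rewrite memP coords_lincomb // -row_mul mulmxBl mul1mx.
  by rewrite orthoproj_id ?orthoproj_eq // subrr row0.
- move=> v; rewrite memP => /eqP v0; exists (coords (frame f (i y)) v).
  rewrite -{1}(lincomb_coords bf v) -[X in lincomb _ X](mulmx1 _) -[X in lincomb _ X]subr0 -v0 -mulmxBr.
  rewrite -/(Q y) mulmx_sum_row linear_sum; apply: eq_bigr => j _.
  by rewrite linearZ.
Qed.

Lemma mem_Lquot x (a : Equot K x) : a \in Lquot K L x <->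
  exists2 e, e \in (perp K x :&: L (i x))%VS & a = qclass K x e.
Proof.
split=> [/memv_imgP[_ /memv_addP[e eL [k kK ->]] ->]|[e eL ->]].
  exists e => //; rewrite linearD /= -[RHS]addr0; congr (_ + _).
  exact: (qproj_eq0 (B := pull i E)).
by apply: memv_img; exact: (subvP (addvSl _ _)).
Qed.

Lemma vsval_qclass x e : e \in perp K x -> vsval (qclass K x e) \in perp K x /\
  e - vsval (qclass K x e) \in K x.
Proof.
by move=> ep; split; [exact: (qproj_mem (B := pull i E))|exact: (qproj_sub (B := pull i E))].
Qed.

Lemma qclass_vsval x (a : Equot K x) : vsval a \in perp K x /\ qclass K x (vsval a) = a.
Proof.
have E0 := qproj_id (B := pull i E) (U := perp K) (V := K) a.
by split=> //; rewrite -E0; exact: (qproj_mem (B := pull i E)).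
Qed.

Lemma qform_qclass x e e' : e \in perp K x -> e' \in perp K x ->
  qform (qclass K x e) (qclass K x e') = cform E (i x) e e'.
Proof.
move=> ep ep'; have [v1 k1] := vsval_qclass ep; have [v2 k2] := vsval_qclass ep'.
set v := vsval _ in v1 k1; set v' := vsval _ in v2 k2.
have z u w : u \in perp K x -> w \in K x -> cform E (i x) u w = 0.
  by move=> /mem_orthovP; exact.
transitivity (cform E (i x) (v + (e - v)) (v' + (e' - v'))); last first.
  by rewrite ![_ + (_ - _)]addrC !subrK.
move: k1 k2; move: (e - v) (e' - v') => k k' k1 k2.
rewrite linearDl !linearDr /= (z v k') // (symmetricC _ k v') (z v' k) //.
by rewrite (z k k') ?(subvP (KK x)) // !addr0.
Qed.

Variables (F : forall x : N, {vspace tangent x}) (nab : connection_op (Equot K)).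
Variables (N' : manifold R) (p : N -> N') (E' : courant N').
Variable phi : forall x, 'Hom(Equot K x, E' (p x)).
Hypothesis quo : is_quotient F nab phi.
Hypothesis phi_form : forall x (a b : Equot K x),
  cform E' (p x) (phi x a) (phi x b) = qform a b.

Definition Lphi x : {vspace E' (p x)} := (phi x @: Lquot K L x)%VS.

Lemma phi_inj x : injective (phi x).
Proof. by have [_ b _ _ _] := quo; exact: bij_inj. Qed.

Lemma phi_surj x w : exists a, phi x a = w.
Proof. by have [_ /(_ x)[g _ gK] _ _ _] := quo; exists (g w). Qed.

Lemma mem_Lphi x a : (phi x a \in Lphi x) = (a \in Lquot K L x).
Proof.
apply/idP/idP => [/memv_imgP[b bL /phi_inj ->]//|]; exact: memv_img.
Qed.

Lemma Lphi_lagrangian x : Lphi x = orthov (cform E' (p x)) (Lphi x).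
Proof.
apply/vspaceP => w; have [a <-] := phi_surj w; rewrite mem_Lphi.
apply/idP/mem_orthovP => [/mem_Lquot[e + ->] _ /memv_imgP[_ /mem_Lquot[e' + ->] ->]|H].
  rewrite !memv_cap => /andP[ep eL] /andP[ep' eL']; rewrite phi_form qform_qclass //.
  by move: eL; rewrite {1}lagrangian_on_N => /mem_orthovP; exact.
have [ap Ea] := qclass_vsval a.
have [|e eL ek] := coisotropic_reduction (@c_nondegenerate _ _ E (i x)) (KK x)
    (lagrangian_on_N x) ap.
  move=> l lp lL; have lq : qclass K x l \in Lquot K L x.
    by apply/mem_Lquot; exists l; rewrite ?memv_cap ?lp.
  have := H _ (memv_img (phi x) lq); rewrite phi_form -{1}Ea qform_qclass //.
apply/mem_Lquot; exists e => //; rewrite -Ea -[vsval a](subrK e) linearD /=.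
by rewrite [X in X + _ = _](qproj_eq0 (B := pull i E)) // add0r.
Qed.

(** Provides the constant rank needed for smoothness of the projector and for L_red as a
    subbundle. *)
Lemma dim_Lphi x : (\dim (Lphi x)).*2 = \dim {:E' (p x)}.
Proof.
apply: (dim_lagrangian (f := cform E' (p x))); first exact: c_nondegenerate.
exact: Lphi_lagrangian.
Qed.

Lemma smooth_phi_qclass (W : set N) (q : section (pull i E)) y : open W -> W y ->
  (forall z, W z -> q z \in perp K z) -> smooth_at y q ->
  smooth_at (b := pull p E') y (fun z => phi z (qclass K z (q z))).
Proof.
move=> oW Wy qp sq; have [_ _ H _ _] := quo; apply/H; exists q => //.
have nW : \forall z \near y, W z by apply: open_nbhs_nbhs.
by apply: filterS nW => z Wz; split; [exact: qp|].
Qed.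

Hypothesis nabF : flat_Fconnection F nab.
Hypothesis inv : invariant_under F nab (Lquot K L).
Hypothesis sp : smooth_map p.
Hypothesis surj_p : forall y, exists x, p x = y.

(** Smooth sections of [Equot] are defined by the existence of lifts, so closure under combinations
    is obtained from the vector bundle p^*E_red through phi. *)
Lemma Equot_comb m (g : 'I_m -> N -> R) (s : 'I_m -> section (Equot K)) x :
  (forall j, smooth_fun_at x (g j)) -> (forall j, smooth_at x (s j)) ->
  smooth_at x (fun y => \sum_j g j y *: s j y).
Proof.
have [vE' _ H _ _] := quo; have vp := pull_vbundle sp vE' => sg ss; apply/H.
have sc := smooth_at_comb vp sg (fun j => (H x (s j)).1 (ss j)).
apply: (smooth_at_ext vp _ sc); apply: nearW => y /=.
by rewrite linear_sum; apply: eq_bigr => j _; rewrite linearZ.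
Qed.

Definition psi x : 'Hom(E' (p x), Equot K x) := (phi x)^-1%VF.

Lemma psiK x w : phi x (psi x w) = w.
Proof.
have [a <-] := phi_surj w; rewrite /psi lker0_lfunK //.
by apply/lker0P; exact: phi_inj.
Qed.

Section Frame.
Variables (V : set N') (m : nat) (t : 'I_m -> section E').
Hypothesis lf : local_frame V t.

Definition Lproj x : 'M[R]_m := orthoproj (coords_mx (frame t (p x)) (Lphi x)).

Lemma LprojP x : V (p x) -> forall a, (lincomb (frame t (p x)) a \in Lphi x) = (a <= Lproj x)%MS.
Proof.
by move=> Vx a; rewrite orthoproj_eq mem_lincomb //; exact: frame_basis lf _ Vx.
Qed.

Lemma Lphi_span x0 : V (p x0) -> exists (W : set N) n (q : 'I_n -> section (pull i E)),
  let C y := \matrix_j coords (frame t (p y)) (phi y (qclass K y (q j y))) in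
  [/\ open W, W x0 & forall y, W y -> [/\ V (p y),
    forall j, smooth_at y (q j),
    forall j, q j y \in (perp K y :&: L (i y))%VS,
    smooth_mx y C & (C y :=: coords_mx (frame t (p y)) (Lphi y))%MS]].
Proof.
move=> Vx0; have [W [n [q [oW Wx0 HW]]]] := perp_cap_span x0.
have lfp := pull_frame sp lf; have [oV _ _] := lfp.
exists (W `&` p @^-1` V), n, q; split=> [||y [Wy Vy]]; [exact: openI|by []|].
have [sq qL qS] := HW y Wy; have bt := frame_basis lf Vy; split=> //.
  move=> j c; have E0 : (fun z => (\matrix_j coords (frame t (p z)) (phi z (qclass K z (q j z)))) j c) =
      (fun z => coords (frame t (p z)) (phi z (qclass K z (q j z))) 0 c).
    by apply/funext => z; rewrite mxE.
  rewrite E0; have := smooth_phi_qclass oW Wy (q := q j) _ (sq j).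
  move=> H; have {}H := H _; apply: (fun h => (smooth_rowP _ _).1 ((frame_smoothP lfp _ Vy).1 h) c).
  apply: H => z Wz; have [_ + _] := HW z Wz.
  by move=> /(_ j); rewrite memv_cap => /andP[].
apply: span_coords_mx => // [j|v /memv_imgP[a /mem_Lquot[e /qS[b ->] ->] ->]].
  by rewrite mem_Lphi; apply/mem_Lquot; exists (q j y).
exists b; rewrite !linear_sum; apply: eq_bigr => j _.
by rewrite !linearZ.
Qed.

Lemma smooth_Lproj x : V (p x) -> smooth_mx x Lproj.
Proof.
move=> Vx; have [W [n [q [oW Wx HW]]]] := Lphi_span Vx.
set C := fun y => _ in HW.
have nW : \forall z \near x, W z by apply: open_nbhs_nbhs.
have rC y : W y -> (\rank (C y)).*2 = m.
  move=> /HW[Vy _ _ _ ->]; have bt := frame_basis lf Vy.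
  by rewrite rank_coords_mx // dim_Lphi (size_basis bt).
have sC : smooth_mx x (fun y => orthoproj (C y)).
  apply: smooth_orthoproj; first by have [] := HW x Wx.
  by apply: filterS nW => y Wy; rewrite -leq_double !rC.
apply: smooth_mx_ext sC; apply: filterS nW => y /HW[_ _ _ _ Cy].
exact: orthoproj_eqmx.
Qed.

Definition Lsec k x : Equot K x := \sum_j Lproj x k j *: psi x (t j (p x)).

Lemma phi_Lsec k x : phi x (Lsec k x) = lincomb (frame t (p x)) (row k (Lproj x)).
Proof.
rewrite linear_sum lincomb_frame; apply: eq_bigr => j _.
by rewrite linearZ [row k _ _ _]mxE; congr (_ *: _); exact: psiK.
Qed.

Lemma Lsec_mem k x : V (p x) -> Lsec k x \in Lquot K L x.
Proof. by move=> Vx; rewrite -mem_Lphi phi_Lsec LprojP // row_sub. Qed.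

Lemma psi_flat (t0 : section E') (V0 : set N') : open V0 -> secs V0 t0 ->
  flat_secs F nab (p @^-1` V0) (fun x => psi x (t0 (p x))).
Proof.
by move=> oV0 st; have [_ _ _ H _] := quo; apply: (H V0 t0) => // x _; exact: psiK.
Qed.

Lemma frame_flat j : flat_secs F nab (p @^-1` V) (fun x => psi x (t j (p x))).
Proof.
by have [oV _ _] := lf; apply: psi_flat => // y Vy; exact: frame_smooth lf _ _ Vy.
Qed.

Lemma Lproj_constant (W : set N) Y x : open W -> W `<=` p @^-1` V ->
  subsecs (B := tbun N) F W Y -> W x ->
  forall k j, dirder x (Y x) (fun y => Lproj y k j) = 0.
Proof.
move=> oW WV YF Wx; have Vx := WV x Wx.
have sP y : W y -> smooth_mx y Lproj by move=> /WV; exact: smooth_Lproj.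
pose D := \matrix_(k, j) dirder x (Y x) (fun y => Lproj y k j).
have ss k : secs W (Lsec k).
  move=> y Wy; apply: Equot_comb => j; first exact: sP.
  by have [+ _] := frame_flat j; apply; exact: WV.
have nabs k : nab Y (Lsec k) x = \sum_j D k j *: psi x (t j (p x)).
  rewrite (connection_comb nabF Equot_comb oW YF Wx) => [|j y Wy|j y Wy].
  - apply: eq_bigr => j _; have [_ fl] := frame_flat j.
    by rewrite (fl W Y oW WV YF x Wx) scaler0 add0r mxE.
  - exact: sP.
  - by have [+ _] := frame_flat j; apply; exact: WV.
(* The pulled-back frame is flat, so by Leibniz row k of D gives the coordinates of nab Y (Lsec k)
   at x. Invariance places that value in L_quot, where the projector acts as the identity. *)
have DP : D *m Lproj x = D.
  apply/row_matrixP => k; rewrite row_mul orthoproj_id // -(orthoproj_eq (coords_mx _ _)).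
  rewrite -LprojP // lincomb_frame.
  have -> : \sum_j row k D 0 j *: t j (p x) = phi x (nab Y (Lsec k) x).
    rewrite nabs linear_sum; apply: eq_bigr => j _.
    by rewrite linearZ mxE; congr (_ *: _); exact: (esym (psiK _)).
  rewrite mem_Lphi; have [|_] := inv oW YF (s := Lsec k); last exact.
  by split=> // y /WV; exact: Lsec_mem.
suff D0 : D = 0 by move=> k j; have := congr1 (fun B : 'M[R]_m => B k j) D0; rewrite !mxE.
apply: (@projector_derivative _ _ (Lproj x)).
- by rewrite orthoproj_id // orthoproj_eq.
- exact: orthoproj_tr.
- apply/matrixP => k j; rewrite !mxE; congr (dirder _ _ _); apply/funext => y.
  have := congr1 (fun B : 'M[R]_m => B j k) (orthoproj_tr (coords_mx (frame t (p y)) (Lphi y))).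
  by rewrite [X in X = _]mxE.
(* Freezing the value at x confines the rewriting by P = P P to the differentiated function, whose
   Leibniz rule gives D = D P + P D. *)
- set Q := Lproj x; have EQ : Q = Lproj x by []; clearbody Q.
  apply/matrixP => k j; rewrite !mxE.
  have -> : (fun y => Lproj y k j) = (fun y => \sum_l Lproj y k l * Lproj y l j).
    apply/funext => y; have : Lproj y *m Lproj y = Lproj y.
      by rewrite orthoproj_id // orthoproj_eq.
    by move=> {1}<-; rewrite mxE.
  rewrite dirder_sum => [|l]; last by apply: smooth_fun_atM; exact: sP.
  rewrite -big_split /=; apply: eq_bigr => l _; rewrite !mxE.
  by rewrite dirderM; [rewrite addrC EQ|exact: sP|exact: sP].
- by rewrite mulmxBr mulmx1 DP subrr.
Qed.

(* Since the coefficients of the projector are constant along F, its rows give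
   flat sections of E_quot, which descend by the definition of the quotient. *)
Lemma Lproj_descends : exists2 P : N' -> 'M[R]_m, (forall y, V y -> smooth_mx y P) &
  forall x, V (p x) -> Lproj x = P (p x).
Proof.
have [oV _ _] := lf; have oVp : open (p @^-1` V) by have [] := pull_frame sp lf.
have flat k : flat_secs F nab (p @^-1` V) (Lsec k).
  split=> [y Vy|W Y oW WV YF x Wx].
    apply: Equot_comb => j; first exact: smooth_Lproj.
    by have [+ _] := frame_flat j; exact.
  have Vx := WV x Wx; rewrite (connection_comb nabF Equot_comb oW YF Wx) => [|j y Wy|j y Wy].
  - rewrite big1 // => j _; have [_ fl] := frame_flat j.
    by rewrite (fl W Y oW WV YF x Wx) scaler0 add0r (Lproj_constant oW WV YF Wx) scale0r.
  - exact: smooth_Lproj (WV y Wy) _ _.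
  - by have [+ _] := frame_flat j; apply; exact: WV.
have /choice[u Hu] k : exists u : section E', secs V u /\
    forall x, V (p x) -> phi x (Lsec k x) = u (p x).
  by have [_ _ _ _ H] := quo; have [u su Eu] := H V (Lsec k) oV (flat k); exists u.
exists (fun y => \matrix_k coords (frame t y) (u k y)) => [y Vy k j|x Vx].
  have E0 : (fun z => (\matrix_k coords (frame t z) (u k z)) k j) =
      (fun z => coords (frame t z) (u k z) 0 j) by apply/funext => z; rewrite mxE.
  rewrite E0; have [su _] := Hu k.
  by have /(frame_smoothP lf _ Vy)/smooth_rowP := su y Vy; exact.
apply/row_matrixP => k; rewrite rowK; have [_ Eu] := Hu k.
by rewrite -Eu // phi_Lsec coords_lincomb //; exact: frame_basis lf _ Vx.
Qed.

End Frame.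

(** For points x of one fibre the subspaces [Lphi x] live in types equal only propositionally, so
    they are transported to the fibre over y. In a frame near y each of them has row space P y,
    hence they coincide. *)
Lemma Lred_exists : exists Lr : forall y, {vspace E' y}, forall x, Lphi x = Lr (p x).
Proof.
pose tr x y (e : p x = y) : {vspace E' y} := eq_rect (p x) (fun y => {vspace E' y}) (Lphi x) y e.
have H y : exists Wy : {vspace E' y}, forall x (e : p x = y), tr x y e = Wy.
  have [U [m [t [Uy lf]]]] := vbundle_frame y (c_vbundle E').
  have [P _ EP] := Lproj_descends lf.
  have Q x (e : p x = y) a : (lincomb (frame t y) a \in tr x y e) = (a <= P y)%MS.
    by move: Uy; case: _ / e => Ux /=; rewrite (LprojP lf) // EP.
  have [x0 e0] := surj_p y; exists (tr x0 y e0) => x e; apply/vspaceP => v.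
  by rewrite -(lincomb_coords (frame_basis lf Uy) v) !Q.
exists (fun y => sval (cid (H y))) => x.
by rewrite -(svalP (cid (H (p x))) x erefl).
Qed.

(** * The reduced subbundle as a quotient and as a Dirac structure *)

Section Reduced.
Variable Lr : forall y, {vspace E' y}.
Hypothesis LrE : forall x, Lphi x = Lr (p x).

Lemma Lr_lagrangian y : Lr y = orthov (cform E' y) (Lr y).
Proof. by have [x <-] := surj_p y; rewrite -LrE -Lphi_lagrangian. Qed.

Lemma mem_Lr x a : (phi x a \in Lr (p x)) = (a \in Lquot K L x).
Proof. by rewrite -LrE mem_Lphi. Qed.

Lemma Lr_local y : exists (U : set N') r (t : 'I_r -> section E') (P : N' -> 'M[R]_r),
  [/\ local_frame U t, U y, (forall z, U z -> smooth_mx z P),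
    (forall z, U z -> (P z :=: coords_mx (frame t z) (Lr z))%MS) &
    (forall z, U z -> \dim (Lr z) = \dim (Lr y))].
Proof.
have [U [m [t [Uy lf]]]] := vbundle_frame y (c_vbundle E').
have [P sP EP] := Lproj_descends lf.
have dLr z : U z -> (\dim (Lr z)).*2 = m.
  have [x <-] := surj_p z => Ux.
  by rewrite -LrE dim_Lphi (size_basis (frame_basis lf Ux)).
exists U, m, t, P; split=> // z Uz.
  have [x Ex] := surj_p z; move: Uz; rewrite -Ex => Ux.
  by rewrite -EP // -LrE; exact: orthoproj_eq.
by apply: double_inj; rewrite !dLr.
Qed.

Lemma Lr_vbundle : is_vbundle (subbun Lr).
Proof. by apply: subbun_vbundle; [exact: c_vbundle|exact: Lr_local]. Qed.

Lemma Lr_subbundle : is_subbundle (B := pull (fun y : N' => y) E') Lr.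
Proof.
move=> y; have [U [r [t [P [lf Uy sP PL dLr]]]]] := Lr_local y.
have [W [k [A [oW Wy HW]]]] := row_space_frame lf Uy sP PL dLr.
exists W, k, (fun j z => lincomb (frame t z) (row j (A z))); split=> // [j z Wz|z Wz].
  have [Uz sA _ _ _] := HW z Wz.
  exact: (@smooth_at_pull _ _ _ (fun z => z) E' z _ (smooth_row_lincomb j lf Uz sA)).
by have [_ _ _ _ b] := HW z Wz.
Qed.

Lemma val_sub_hom x (u : subbun (Lquot K L) x) :
  vsval (sub_hom phi (Lquot K L) Lr x u) = phi x (vsval u).
Proof.
pose f (u : subvs_of (Lquot K L x)) := vsproj (Lr (p x)) (phi x (vsval u)).
have flin : linear f by move=> a v w; rewrite /f !linearP.
pose fM := GRing.isLinear.Build _ _ _ _ f flin.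
pose fL : {linear subvs_of (Lquot K L x) -> subvs_of (Lr (p x))} := HB.pack f fM.
have -> : sub_hom phi (Lquot K L) Lr x u = f u := lfunE fL u.
by rewrite vsprojK // mem_Lr subvsP.
Qed.

Lemma sub_hom_bij x : bijective (sub_hom phi (Lquot K L) Lr x).
Proof.
have psi_mem w : w \in Lr (p x) -> psi x w \in Lquot K L x.
  by rewrite -mem_Lr psiK.
exists (fun w => vsproj (Lquot K L x) (psi x (vsval w))) => [u|w]; apply/val_inj.
  rewrite /= vsprojK; last by rewrite psi_mem // subvsP.
  by apply: (@phi_inj x); rewrite psiK val_sub_hom.
by rewrite [LHS]val_sub_hom /= vsprojK ?psiK // psi_mem // subvsP.
Qed.

(** Pullback smoothness asks for sections of L_red itself, so the forward direction builds a local
    frame [tau] of L_red and takes smooth coefficients in it. *)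
Lemma sub_hom_smooth x (s : section (subbun (Lquot K L))) : smooth_at x s <->
  smooth_at (b := pull p (subbun Lr)) x (fun y => sub_hom phi (Lquot K L) Lr y (s y)).
Proof.
have [_ _ Hq _ _] := quo; have Hx := Hq x (fun y => vsval (s y)).
split=> [ss|[m [t0 [g [st sg E0]]]]]; last first.
  apply/Hx; exists m, (fun j y => vsval (t0 j y)), g; split=> //.
  by apply: filterS E0 => y Ey; rewrite -val_sub_hom Ey linear_sum;
    apply: eq_bigr => j _; rewrite linearZ.
have [U [r [t [P [lf Ux sP PL dLr]]]]] := Lr_local (p x).
have [W [k [A [oW Wx HW]]]] := row_space_frame lf Ux sP PL dLr.
have lfp := pull_frame sp lf.
have sc := (frame_smoothP lfp _ Ux).1 (Hx.1 ss).
have [_ sA fA _ _] := HW _ Wx.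
have [d sd Ed] := smooth_coefficients (smooth_mx_comp sp sA) fA sc.
pose tau j y := vsproj (Lr y) (lincomb (frame t y) (row j (A y))).
have tauK j y : W y -> vsval (tau j y) = lincomb (frame t y) (row j (A y)).
  by move=> /HW[Uy _ _ AL _]; rewrite vsprojK // -mem_lincomb -?AL ?row_sub //; exact: frame_basis lf _ Uy.
have nW : \forall y \near p x, W y by apply: open_nbhs_nbhs.
exists k, tau, (fun j y => d y 0 j); split.
- move=> j; apply: (smooth_at_ext (c_vbundle E') _ (smooth_row_lincomb j lf Ux sA)).
  by apply: filterS nW => y Wy; rewrite tauK.
- by have /smooth_rowP := sd.
have [cp _] := sp; have npW := cp x _ nW; near=> y.
have Wy : W (p y) by near: y.
have [Uy _ _ AL _] := HW _ Wy; have bt := frame_basis lf Uy.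
have Ey : coords (frame t (p y)) (phi y (vsval (s y))) = d y *m A (p y).
  suff : (coords (frame t (p y)) (phi y (vsval (s y))) <= A (p y))%MS by near: y.
  by rewrite AL mem_coords_mx // mem_Lr subvsP.
apply/val_inj; rewrite [LHS]val_sub_hom -[LHS](lincomb_coords bt) Ey mulmx_sum_row !linear_sum.
by apply: eq_bigr => j _; rewrite !linearZ; congr (_ *: _); rewrite -[RHS]/(vsval (tau j (p y))) tauK.
Unshelve. all: by end_near. Qed.

Lemma sub_is_quotient : is_quotient F (sub_connection nab (L := Lquot K L))
  (sub_hom phi (Lquot K L) Lr).
Proof.
have [vE' _ _ q4 q5] := quo; have [cp _] := sp.
split; [exact: Lr_vbundle|exact: sub_hom_bij|exact: sub_hom_smooth| |].
- move=> V t s oV st E0.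
  have [ss fl] := q4 V (fun y => vsval (t y)) (fun x => vsval (s x)) oV st
    (fun x Vx => etrans (esym (val_sub_hom (s x))) (congr1 vsval (E0 x Vx))).
  split=> [x Vx|W Y oW WV YF x Wx]; first exact: ss.
  by rewrite /sub_connection (fl W Y oW WV YF x Wx) linear0.
- move=> V s oV [ss fl].
  have [|t st E0] := q5 V (fun x => vsval (s x)) oV.
    split=> [x Vx|W Y oW WV YF x Wx]; first exact: ss.
    (* By invariance the projection in [sub_connection] changes nothing, so flatness in the
       subbundle is flatness for nab. *)
    have [|_ nL] := inv oW YF (s := fun x => vsval (s x)).
      by split=> [y Wy|y _]; [apply: ss; exact: WV|exact: subvsP].
    have := congr1 vsval (fl W Y oW WV YF x Wx).
    by rewrite /sub_connection vsprojK ?nL // => ->; exact: (linear0 (@vsval R _ _)).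
  have tL y : V y -> t y \in Lr y.
    have [x <-] := surj_p y => Vx; rewrite -(E0 x Vx) mem_Lr; exact: subvsP.
  exists (fun y => vsproj (Lr y) (t y)) => [y Vy|x Vx].
    apply: (smooth_at_ext vE' _ (st y Vy)).
    have nV : \forall z \near y, V z by apply: open_nbhs_nbhs.
    by apply: filterS nV => z Vz; rewrite vsprojK // tL.
  by apply/val_inj; rewrite [LHS]val_sub_hom E0 //= vsprojK // tL.
Qed.

Hypothesis nab_lift : forall (U : set M) (e1 e2 : section E), open U ->
  flat_along F nab U e1 -> flat_along F nab U e2 -> flat_along F nab U (cbrk E e1 e2).
Hypothesis phi_brk : forall (U : set M) (V : set N') (e1 e2 : section E) (t1 t2 : section E'),
  open U -> open V -> flat_along F nab U e1 -> flat_along F nab U e2 ->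
  secs V t1 -> secs V t2 ->
  (forall x, U (i x) -> V (p x) ->
    phi x (qclass K x (e1 (i x))) = t1 (p x) /\
    phi x (qclass K x (e2 (i x))) = t2 (p x)) ->
  forall x, U (i x) -> V (p x) ->
    phi x (qclass K x (cbrk E e1 e2 (i x))) = cbrk E' t1 t2 (p x).

Lemma smooth_Equot_ext x (s s' : section (Equot K)) :
  (\forall y \near x, s y = s' y) -> smooth_at x s -> smooth_at x s'.
Proof.
move=> ss' [t st Et]; exists t => //; apply: filterS2 ss' Et => y E0 [tU tq].
by rewrite -E0.
Qed.

Lemma flat_secs_ext (W W' : set N) (s s' : section (Equot K)) : open W' ->
  W' `<=` W -> (forall x, W' x -> s x = s' x) -> flat_secs F nab W s ->
  flat_secs F nab W' s'.
Proof.
move=> oW' W'W ss' [sm fl].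
have sm' : secs W' s'.
  move=> x Wx; apply: smooth_Equot_ext (sm x (W'W x Wx)).
  have nW : \forall y \near x, W' y by apply: open_nbhs_nbhs.
  by apply: filterS nW; exact: ss'.
split=> // V Y oV VW' YF x Vx; have [_ ext _ _ _] := nabF oV.
rewrite -(ext Y Y s s') //; last by move=> y Vy; split=> //; apply: ss'; exact: VW'.
- by apply: (fl V Y) => // y Vy; apply: W'W; exact: VW'.
- by move=> y Vy; apply: sm; apply: W'W; exact: VW'.
- by move=> y Vy; apply: sm'; exact: VW'.
Qed.

Lemma flat_along_sub (U U' : set M) (e : section E) : open U' -> U' `<=` U ->
  flat_along F nab U e -> flat_along F nab U' e.
Proof.
move=> oU' UU [[se ep] fl]; have [[ci _] _ _ _] := ei.
have oUN : open (i @^-1` U') by apply: open_comp => // x _; exact: ci.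
split; first by split=> [y /UU|x /UU]; [exact: se|exact: ep].
by apply: (flat_secs_ext oUN _ _ fl) => // x /UU.
Qed.

(* A section of L_red is lifted to a section of K^perp /\ L over N, and its
   coefficients in a frame of L are then extended from N to M. *)
Lemma lift_section (t : section E') x0 : secs setT t -> (forall y, t y \in Lr y) ->
  exists (U : set M) (e : section E), [/\ open U, U (i x0), flat_along F nab U e,
    (forall x, U (i x) -> phi x (qclass K x (e (i x))) = t (p x)) &
    (forall z, U z -> range iS z -> e z \in L z)].
Proof.
move=> st tL; have [si _ inji _] := ei; have [ci _] := si.
have [V [m [f [Vx lf]]]] := vbundle_frame (p x0) (c_vbundle E').
have [W [n [q [oW Wx HW]]]] := Lphi_span lf Vx; set C := fun y => _ in HW.
have lfp := pull_frame sp lf.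
have rC y : W y -> (\rank (C y)).*2 = m.
  move=> /HW[Vy _ _ _ ->]; have bt := frame_basis lf Vy.
  by rewrite rank_coords_mx // dim_Lphi (size_basis bt).
have nW : \forall y \near x0, W y by apply: open_nbhs_nbhs.
have sC : smooth_mx x0 C by have [] := HW x0 Wx.
have nr : \forall y \near x0, (\rank (C y) <= \rank (C x0))%N.
  by apply: filterS nW => y Wy; rewrite -leq_double !rC.
(* The lifts q only span, so those whose images are independent at x0 are selected. Their images
   remain a basis of L_red nearby, and t has smooth coefficients in it. *)
have [g gP] := constant_rank_rows sC nr.
pose B y := rowsub g (C y).
have sB : smooth_mx x0 B by move=> j l; under eq_fun do rewrite mxE; exact: sC.
have [fB _] := nbhs_singleton gP.
have sct : smooth_mx x0 (fun y => coords (frame f (p y)) (t (p y))).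
  have stp := smooth_at_pull (f := p) (st (p x0) I).
  exact: (frame_smoothP lfp _ Vx).1 stp.
have [c sc Ec] := smooth_coefficients sB fB sct.
pose u : section (pull i E) := fun y => \sum_j c y 0 j *: q (g j) y.
have su : smooth_at x0 u.
  apply: smooth_at_comb; first exact: pull_vbundle si (c_vbundle E).
    by have /smooth_rowP := sc.
  by move=> j; have [] := HW x0 Wx.
have uP : \forall y \near x0, u y \in (perp K y :&: L (i y))%VS /\
    phi y (qclass K y (u y)) = t (p y).
  near=> y; have Wy : W y by near: y.
  have [fy By] : row_free (B y) /\ (B y :=: C y)%MS by near: y.
  have [Vy _ qL _ CL] := HW y Wy; have bf := frame_basis lf Vy.
  split; first by apply: memv_suml => j _; exact: memvZ.
  have Ey : coords (frame f (p y)) (t (p y)) = c y *m B y.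
    suff : (coords (frame f (p y)) (t (p y)) <= B y)%MS by near: y.
    by rewrite By CL mem_coords_mx // LrE tL.
  rewrite -[RHS](lincomb_coords bf) Ey mulmx_sum_row !linear_sum; apply: eq_bigr => j _.
  rewrite !linearZ; congr (_ *: _).
  have -> : row j (B y) = coords (frame f (p y)) (phi y (qclass K y (q (g j) y))).
    by apply/rowP => l; rewrite !mxE.
  by rewrite [RHS](lincomb_coords bf).
have [s0 _ Es] : range iS (i x0) by apply: rS; exists x0.
have [sL _ _ _] := dL.
have [VL [b [l [oVL VLx sl bl]]]] := extend_frame s0 (c_vbundle E) eS sL.
rewrite Es in VLx.
have {}bl z : VL z -> range iS z -> basis_of (L z) (frame l z).
  by move=> + [s _ Ez]; rewrite -Ez; exact: bl.
have blN y : VL (i y) -> basis_of (L (i y)) (frame l (i y)).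
  by move=> Vy; apply: bl => //; apply: rS; exists y.
have [UE [n' [h [Ux lh]]]] := vbundle_frame (i x0) (c_vbundle E).
have lhN := pull_frame si lh.
pose AL y := \matrix_(j < b) coords (frame h (i y)) (l j (i y)).
have sAL : smooth_mx x0 AL.
  move=> j r; have -> : (fun y => AL y j r) = (fun y => coords (frame h (i y)) (l j (i y)) 0 r).
    by apply/funext => y; rewrite mxE.
  have := smooth_at_pull (f := i) (sl j _ VLx).
  by move=> /(frame_smoothP lhN _ Ux)/smooth_rowP; exact.
have fAL : row_free (AL x0).
  have bh := frame_basis lh Ux.
  by rewrite /row_free (basis_coords_mx bh (blN x0 VLx)) rank_coords_mx // (size_basis (blN x0 VLx)).
have sud := (frame_smoothP lhN _ Ux).1 su.
have [d sd Ed] := smooth_coefficients sAL fAL sud.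
have /choice[D HD] j : exists D : M -> R, smooth_fun_at (i x0) D /\
    \forall y \near x0, D (i y) = d y 0 j.
  have sdj : smooth_fun_at x0 (fun y => d y 0 j) by have /smooth_rowP := sd; exact.
  by have [D sD ED] := smooth_extension si (inji x0) sdj; exists D.
(* Being a combination of sections that span L along S, e lies in L at all nearby points of S and
   not only along N, as the Dirac condition over S demands. *)
pose e : section E := fun z => \sum_j D j z *: l j z.
have se : smooth_at (i x0) e.
  apply: (smooth_at_comb (c_vbundle E)) => j; first by have [] := HD j.
  exact: sl.
have nD : \forall y \near x0, forall j, D j (i y) = d y 0 j.
  by apply: (@filter_forall _ _ _ (nbhs x0)) => j; have [] := HD j.
have nVL : \forall y \near x0, VL (i y) by apply: ci; apply: open_nbhs_nbhs.
have nUE : \forall y \near x0, UE (i y) := ci x0 _ (frame_near lh Ux).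
have eu : \forall y \near x0, e (i y) = u y /\ (u y \in (perp K y :&: L (i y))%VS /\
    phi y (qclass K y (u y)) = t (p y)).
  near=> y; have uy : u y \in (perp K y :&: L (i y))%VS /\
    phi y (qclass K y (u y)) = t (p y) by near: y.
  split=> //; have Vy : VL (i y) by near: y.
  have Uy : UE (i y) by near: y.
  have bh := frame_basis lh Uy.
  have Ey : coords (frame h (i y)) (u y) = d y *m AL y.
    suff : (coords (frame h (i y)) (u y) <= AL y)%MS by near: y.
    rewrite (basis_coords_mx bh (blN y Vy)) mem_coords_mx //.
    by move: uy; rewrite memv_cap => -[/andP[]].
  have Dy : forall j, D j (i y) = d y 0 j by near: y.
  rewrite -[RHS](lincomb_coords bh) Ey mulmx_coords lincomb_coords //; apply: eq_bigr => j _.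
  by rewrite Dy.
have [U1 [oU1 U1x HU1]] := embedding_open ei eu.
have [U2 [oU2 U2x HU2]] := near_open (smooth_at_near (c_vbundle E) se).
pose U := U1 `&` U2 `&` VL.
have oU : open U by apply: openI => //; exact: openI.
exists U, e; split=> //.
- split; first by split=> [z [[_ /HU2]]|x [[/HU1[-> [+ _]] _] _]] //; rewrite memv_cap => /andP[].
  have oUN : open (i @^-1` U) by apply: open_comp => // x _; exact: ci.
  (* Along N the class of e is the pullback of t, which is flat by the definition of the
     quotient. *)
  apply: (flat_secs_ext oUN _ _ (psi_flat openT st)) => // x [[/HU1[Ex [_ Ey]] _] _].
  by apply: (@phi_inj x); rewrite psiK -Ey Ex.
- by move=> x [[/HU1[-> [_ ->]]]].
- by move=> z [_ Vz] rz; apply: memv_suml => j _; apply: memvZ; apply: (basis_mem (bl z Vz rz));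
    apply/mapP; exists j; rewrite ?mem_enum.
Unshelve. all: by end_near. Qed.

Lemma bump_section (U : set M) (chi : M -> R) (e : section E) : open U ->
  (forall y, smooth_fun_at y chi) -> (forall y, U y \/ \forall z \near y, chi z = 0) ->
  secs U e -> secs setT (fun z => chi z *: e z).
Proof.
move=> oU sc c0 se y _; have [Uy|cy] := c0 y.
  by apply: (smooth_atZ (c_vbundle E)) => //; exact: se.
apply: (smooth_at_ext (c_vbundle E) _ (smooth_at0 (c_vbundle E) y)).
by apply: filterS cy => z ->; rewrite scale0r.
Qed.

(** The local flat lifts show that the bracket lies in K^perp and represents the reduced bracket;
    membership in L is tested on their cut-off versions. *)
Lemma Lr_involutive (t1 t2 : section E') x0 : secs setT t1 -> secs setT t2 ->
  (forall y, t1 y \in Lr y) -> (forall y, t2 y \in Lr y) ->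
  cbrk E' t1 t2 (p x0) \in Lr (p x0).
Proof.
move=> st1 st2 tL1 tL2.
have [U1 [e1 [oU1 U1x f1 p1 l1]]] := lift_section x0 st1 tL1.
have [U2 [e2 [oU2 U2x f2 p2 l2]]] := lift_section x0 st2 tL2.
pose U := U1 `&` U2; have oU : open U by exact: openI.
have Ux : U (i x0) by [].
have {}f1 : flat_along F nab U e1 by apply: flat_along_sub f1 => // z [].
have {}f2 : flat_along F nab U e2 by apply: flat_along_sub f2 => // z [].
have f12 := nab_lift oU f1 f2.
have [[se1 _] _] := f1; have [[se2 _] _] := f2; have [[_ p12] _] := f12.
have <- : phi x0 (qclass K x0 (cbrk E e1 e2 (i x0))) = cbrk E' t1 t2 (p x0).
  by apply: (phi_brk oU openT f1 f2 st1 st2) => // x [/p1 ? /p2 ?].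
rewrite mem_Lr; apply/mem_Lquot; exists (cbrk E e1 e2 (i x0)) => //.
rewrite memv_cap p12 //=.
have [chi [sc c0 c1]] := smooth_bump oU Ux.
pose b1 : section E := fun z => chi z *: e1 z; pose b2 : section E := fun z => chi z *: e2 z.
have sb1 : secs setT b1 by exact: bump_section oU sc c0 se1.
have sb2 : secs setT b2 by exact: bump_section oU sc c0 se2.
have bL (e : section E) s : (forall z, U z -> range iS z -> e z \in L z) ->
    chi (iS s) *: e (iS s) \in L (iS s).
  move=> eL; have [Us|/nbhs_singleton ->] := c0 (iS s).
    by apply: memvZ; apply: eL => //; exists s.
  by rewrite scale0r mem0v.
have [s0 _ Es] : range iS (i x0) by apply: rS; exists x0.
have [_ _ _ dirac] := dL.
have H : cbrk E b1 b2 (i x0) \in L (i x0).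
  rewrite -Es; apply: dirac => // s.
    by apply: bL => z [U1z _]; exact: l1.
  by apply: bL => z [_ U2z]; exact: l2.
have [W [oW Wx W1]] := near_open c1.
suff <- : cbrk E b1 b2 (i x0) = cbrk E e1 e2 (i x0) by [].
apply: (@cbrk_local _ _ E (W `&` U)) => //; first exact: openI.
- by move=> z _; exact: sb1.
- by move=> z _; exact: sb2.
- by move=> z [_ /se1].
- by move=> z [_ /se2].
- by move=> z [/W1 cz _]; rewrite /b1 /b2 cz !scale1r.
Qed.

Lemma Lr_is_dirac : is_dirac (fun y : N' => y) Lr.
Proof.
split; [exact: Lr_subbundle|exact: Lr_lagrangian| |].
  move=> y e _; exists (anchor E' y e).
  have cy := chart_at_dom y.
  (* In charts the identity map is chart after inverse chart, which agrees with the identity only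
     near the point. *)
  have n : {near chart_at y y, idfun =1 chart_at y \o (fun z => z) \o cinv (chart_at y)}.
    by apply: filterS (cimg_nbhs cy) => z [_ Ez]; rewrite /= Ez.
  have idc : continuous (idfun : 'rV[R]_(mdim N') -> 'rV[R]_(mdim N')).
    by move=> z; exact: cvg_id.
  have [|_ dE] := diff_near_eq n; first exact: linear_differentiable.
  have dI := @diff_lin _ _ _ idfun (chart_at y y) idc.
  exact: (esym (congr1 (@^~ (anchor E' y e)) (etrans dE dI))).
move=> t1 t2 st1 st2 L1 L2 y; have [x <-] := surj_p y.
exact: Lr_involutive.
Qed.

End Reduced.

End ReducedDirac.

Theorem theorem7p11 (R : realType) (M : manifold R) (E : courant M)
  (N : manifold R) (i : N -> M)
  (K : forall x : N, {vspace E (i x)})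
  (F : forall x : N, {vspace tangent x})
  (nab : connection_op (Equot K))
  (N' : manifold R) (p : N -> N')
  (E_red : courant N') (phi : forall x, 'Hom(Equot K x, E_red (p x)))
  (S : manifold R) (iS : S -> M) (L : forall x : M, {vspace E x}) :
  geometric_coisotropic_data F nab ->
  reducible F nab ->
  simple_foliation F p ->
  is_quotient F nab phi ->
  is_reduced_courant F nab phi ->
  embedding iS ->
  range i `<=` range iS ->
  is_dirac iS L ->
  (exists r : nat, forall x : N, \dim (L (i x) :&: K x) = r) ->
  invariant_under F nab (Lquot K L) ->
  exists L_red : forall y : N', {vspace E_red y},
    [/\ forall x, (phi x @: Lquot K L x)%VS = L_red (p x),
        is_quotient F (sub_connection nab (L := Lquot K L))
          (sub_hom phi (Lquot K L) L_red) &
        is_dirac (fun y : N' => y) L_red].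
Proof.
move=> [ei [sK KK] _ nabF _] [_ _ _ nab_lift] [sp surj_p _ _ _] quo.
move=> [phi_form _ phi_brk] eS rS dL rk inv.
have [Lr LrE] := Lred_exists ei sK KK eS rS dL rk quo phi_form nabF inv sp surj_p.
exists Lr; split.
- exact: LrE.
- exact: (sub_is_quotient ei sK KK eS rS dL rk quo phi_form nabF inv sp surj_p LrE).
- exact: (Lr_is_dirac ei sK KK eS rS dL rk quo phi_form nabF inv sp surj_p LrE).
Qed.
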